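(* Let $N\in\mathbb{N}$, let $0<q<1$ (possibly depending on $N$), let $A$ be an $N\times N$ random matrix with independent Bernoulli$(q)$ entries, and let $\gamma_{sqc}=\max(q,1-q)$ and $\gamma_{qc}=\sqrt{q^2+(1-q)^2}$. Then asymptotically almost surely: (i) If $1\ge 1-\gamma_{sqc}\gg\frac{\log(N)}{N}$, then with $\eta=1+\log_N(\log(1/\gamma_{sqc}))$, $$\mathrm{SQC}(A)\ge(\eta-o(1))\frac{\log(N)}{\log(1/\gamma_{sqc})},\qquad \mathrm{SQCP}(A)\le(1+o(1))\frac{\log(N)}{\log(1/\gamma_{sqc})};$$ (ii) If $\frac{\log(N)}{N}\gg 1-\gamma_{sqc}$, then $\mathrm{SQC}(A)$ is undefined. Moreover, the same statements hold for $\mathrm{QC}(A)$ with $\gamma_{sqc}$ replaced by $\gamma_{qc}$: if $1-\gamma_{qc}\gg\frac{\log N}{N}$ then, with $\eta_{qc}=1+\log_N(\log(1/\gamma_{qc}))$, a.a.s. $(\eta_{qc}-o(1))\frac{\log(N)}{\log(1/\gamma_{qc})}\le\mathrm{QC}(A)\le(1+o(1))\frac{\log(N)}{\log(1/\gamma_{qc})}$, and if $\frac{\log N}{N}\gg 1-\gamma_{qc}$ then $\mathrm{QC}(A)$ is a.a.s. undefined.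
   Context: Rows of $A$ are indexed by $\mathcal{R}=[N]$ (''queries'') and columns by $\mathcal{C}=[N]$ (''targets''); for $R\subseteq\mathcal{R}$, $W\subseteq\mathcal{C}$, $A_{R,W}$ is the submatrix with rows $R$ and columns $W$. $\mathrm{QC}(A)$ (query complexity) is the minimum $|R|$ such that $A_{R,\mathcal{C}}$ has pairwise different columns. Given a target column $v^\star$ and a set of rows $R$, the candidate targets are $\mathcal{T}_R(A)=\{v\in[N]: A_{R,\{v\}}=A_{R,\{v^\star\}}\}$. The sequential query complexity $\mathrm{SQC}(A)$ is the minimum $r\in\mathbb{N}$ for which there is a function $g$ mapping triples $(A,R,A_{R,\{v^\star\}})$ ($R\subseteq\mathcal{R}$, $v^\star\in\mathcal{C}$) to rows in $\mathcal{R}$ such that, setting $R_0=\emptyset$ and $R_{j+1}=R_j\cup\{g(A,R_j,A_{R_j,\{v^\star\}})\}$, one has $|\mathcal{T}_{R_r}(A)|=1$ for every $v^\star\in\mathcal{C}$. $\mathrm{SQCP}(A)$ is defined identically but requiring $g$ to be computable in polynomial time. These quantities are ''undefined'' if no such $R$ / $r$ exists (i.e. $A$ has two identical columns). ''A.a.s.'' (asymptotically almost surely) means with probability tending to $1$ as $N\to\infty$; $f\ll g$ means $f/g\to0$; $\log$ is the natural logarithm and $\log_N x=\log x/\log N$. *)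

(* Defs.v *)
From HB Require Import structures.
From mathcomp Require Import all_boot all_order all_algebra.
From mathcomp Require Import all_classical all_reals all_analysis.

Set Implicit Arguments.
Unset Strict Implicit.
Unset Printing Implicit Defensive.

Import Order.TTheory GRing.Theory Num.Theory.
Import numFieldNormedType.Exports.

Local Open Scope classical_set_scope.
Local Open Scope ring_scope.

(* None stands for "undefined". *)
Definition minimum (P : nat -> Prop) : option nat :=
  match pselect (exists r, `[< P r >]) with
  | left h => Some (ex_minn h)
  | right _ => None
  end.

Section QueryComplexity.
Local Open Scope nat_scope.

(* The submatrix A_{R,{v}}, together with the positions of its rows: the value
   is None exactly outside R. *)
Definition restr_col N (A : 'M[bool]_N) (R : {set 'I_N}) (v : 'I_N) :
    {ffun 'I_N -> option bool} :=
  [ffun i => if i \in R then Some (A i v) else None].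

Definition QC N (A : 'M[bool]_N) : option nat :=
  minimum (fun r => exists R : {set 'I_N}, #|R| = r /\ injective (restr_col A R)).

Definition candidates N (A : 'M[bool]_N) (R : {set 'I_N}) (vstar : 'I_N) :
    {set 'I_N} :=
  [set v | restr_col A R v == restr_col A R vstar]%SET.

(* One strategy handles matrices of every size N = n.+1; N = 0 is excluded since
   there is then no row to query. *)
Definition strategy : Type := forall n : nat,
  'M[bool]_n.+1 -> {set 'I_n.+1} -> {ffun 'I_n.+1 -> option bool} -> 'I_n.+1.

Fixpoint queried (g : strategy) n (A : 'M[bool]_n.+1) (vstar : 'I_n.+1) (j : nat)
    : {set 'I_n.+1} :=
  if j is k.+1 then
    let R := queried g A vstar k in
    (R :|: [set g n A R (restr_col A R vstar)])%SET
  else finset.set0.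

Definition identifies (g : strategy) n (A : 'M[bool]_n.+1) (r : nat) : Prop :=
  forall vstar, #|candidates A (queried g A vstar r) vstar| = 1.

Definition SQC n (A : 'M[bool]_n.+1) : option nat :=
  minimum (fun r => exists g : strategy, identifies g A r).

End QueryComplexity.

(* Polynomial time is formalised with the unit-cost random access machine of
   Cook and Reckhow (registers holding natural numbers; addition and truncated
   subtraction but no multiplication, so that it is polynomially equivalent to
   Turing machines), with random access to a read-only input. *)
Section RandomAccessMachine.
Local Open Scope nat_scope.

Inductive instr :=
  | RConst of nat & nat         (* X_i := c *)
  | RAdd of nat & nat & nat     (* X_i := X_j + X_k *)
  | RSub of nat & nat & nat     (* X_i := X_j - X_k, truncated at 0 *)
  | RLoad of nat & nat          (* X_i := X_(X_j) *)
  | RStore of nat & nat         (* X_(X_i) := X_j *)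
  | RInput of nat & nat         (* X_i := cell number X_j of the input *)
  | RJump of nat & nat.         (* go to instruction l if X_i > 0 *)

Definition ram_state : Type := (nat * (nat -> nat))%type.

Definition upd (X : nat -> nat) (i a : nat) : nat -> nat :=
  fun k => if k == i then a else X k.

Definition ram_step (p : seq instr) (x : seq nat) (s : ram_state) : ram_state :=
  let: (pc, X) := s in
  match onth p pc with
  | None => s
  | Some (RConst i c) => (pc.+1, upd X i c)
  | Some (RAdd i j k) => (pc.+1, upd X i (X j + X k))
  | Some (RSub i j k) => (pc.+1, upd X i (X j - X k))
  | Some (RLoad i j) => (pc.+1, upd X i (X (X j)))
  | Some (RStore i j) => (pc.+1, upd X (X i) (X j))
  | Some (RInput i j) => (pc.+1, upd X i (nth 0 x (X j)))
  | Some (RJump i l) => (if 0 < X i then l else pc.+1, X)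
  end.

(* The machine halts when the program counter leaves the program; the output is
   then the content of X_0. *)
Definition ram_outputs (p : seq instr) (x : seq nat) (t y : nat) : Prop :=
  let s := iter t (ram_step p x) (0, fun=> 0) in
  size p <= s.1 /\ s.2 0 = y.

(* N, the entries of A row by row, the indicator of R, and the observed entries
   (0 outside R); the length is N ^ 2 + 2 * N + 1. *)
Definition encode n (A : 'M[bool]_n.+1) (R : {set 'I_n.+1})
    (y : {ffun 'I_n.+1 -> option bool}) : seq nat :=
  n.+1 :: [seq nat_of_bool (A i j) | i <- enum 'I_n.+1, j <- enum 'I_n.+1]
       ++ [seq nat_of_bool (i \in R) | i <- enum 'I_n.+1]
       ++ [seq nat_of_bool (y i == Some true) | i <- enum 'I_n.+1].

Definition polynomial_time (g : strategy) : Prop :=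
  exists (p : seq instr) (c : nat),
    forall n (A : 'M[bool]_n.+1) (R : {set 'I_n.+1}) (vstar : 'I_n.+1),
      let y := restr_col A R vstar in
      exists2 t, t <= c * n.+1 ^ c & ram_outputs p (encode A R y) t (g n A R y).

(* The number of queries used by one fixed strategy. *)
Definition SQC_by (g : strategy) n (A : 'M[bool]_n.+1) : option nat :=
  minimum (identifies g A).

(* Minimising over polynomial-time strategies for each matrix separately puts no
   uniformity constraint on the choice of the strategy as the matrix varies;
   [SQC_by g] with one polynomial-time g for all matrices expresses it. *)
Definition SQCP n (A : 'M[bool]_n.+1) : option nat :=
  minimum (fun r => exists g : strategy, polynomial_time g /\ identifies g A r).

End RandomAccessMachine.

Section Asymptotics.
Variable R : realType.
Implicit Types (q f g gamma : nat -> R).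

(* The probability of E for an N x N matrix of independent Bernoulli(q) entries. *)
Definition random_matrix_prob N (q : R) (E : 'M[bool]_N -> Prop) : R :=
  \sum_(A : 'M[bool]_N | `[< E A >])
    \prod_(i < N) \prod_(j < N) (if A i j then q else 1 - q).

(* The matrix size is N = n.+1. *)
Definition aas q (E : forall n, 'M[bool]_n.+1 -> Prop) : Prop :=
  random_matrix_prob (q n.+1) (@E n) @[n --> \oo] --> (1 : R).

Definition much_less f g : Prop := f N / g N @[N --> \oo] --> (0 : R).

Definition little_o1 (e : nat -> R) : Prop := e N @[N --> \oo] --> (0 : R).

Definition logN_over_N (N : nat) : R := ln N%:R / N%:R.

Definition gamma_sqc q (N : nat) : R := Num.max (q N) (1 - q N).

Definition gamma_qc q (N : nat) : R := Num.sqrt (q N ^+ 2 + (1 - q N) ^+ 2).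

Definition query_rate gamma (N : nat) : R := ln N%:R / ln (1 / gamma N).

Definition eta_exp gamma (N : nat) : R := 1 + ln (ln (1 / gamma N)) / ln N%:R.

End Asymptotics.

(* Main.v *)
Require Import Defs.
From mathcomp Require Import all_boot all_order all_algebra.
From mathcomp Require Import all_classical all_reals all_analysis.
From mathcomp Require Import zify ring lra.

(** A strategy that has received the majority answer to all of its at most r
    queries cannot distinguish the columns that are constant on the queried
    rows. For a fixed set of r rows about N gamma^r columns are constant, and for
    r below the stated rate this number is so large (N^eps / ln (1 / gamma)) that
    a union bound over all sets of r rows shows that two such columns always
    exist; with all rows queried it shows that two columns of the matrix are
    equal in case (ii). For QC, constant columns are replaced by a birthday
    estimate: n samples from a law p on a finite set are all distinct with
    probability n! e_n(p), which is at most about exp (- n (sum p^2)^(1/2) / 8).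

    For the upper bound on SQC, query a row that splits the current candidates
    most evenly. By Chernoff's inequality and a union bound over sets T of columns,
    whenever |T| >= K := eps ln N / (1 - gamma) some row leaves, for both answers,
    at most a fraction gamma^(1 - 2 eps) of T. Below K candidates it is enough
    that every query separates two candidates, since K is only O(eps) times the
    rate. The upper bound on QC is a union bound over pairs of columns, with the
    first rows queried. *)

Set Implicit Arguments.
Unset Strict Implicit.
Unset Printing Implicit Defensive.

Import Order.TTheory GRing.Theory Num.Theory.
Import numFieldNormedType.Exports.
Local Open Scope ring_scope.

(** * Programs for the random access machine *)

Arguments ram_step : simpl never.

Section StructuredPrograms.
Local Open Scope nat_scope.
Variable x : seq nat.
Implicit Types (X : nat -> nat) (P Q : (nat -> nat) -> Prop).

Definition effect X (c : instr) : nat -> nat :=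
  match c with
  | RConst i a => upd X i a
  | RAdd i j k => upd X i (X j + X k)
  | RSub i j k => upd X i (X j - X k)
  | RLoad i j => upd X i (X (X j))
  | RStore i j => upd X (X i) (X j)
  | RInput i j => upd X i (nth 0 x (X j))
  | RJump _ _ => X
  end.

Definition is_jump (c : instr) := if c is RJump _ _ then true else false.

(* [Repeat r c] runs c until X_r = 0, at least once; [Unless r c] runs c if
   X_r = 0. *)
Inductive code :=
  | Block of seq instr
  | Seq of code & code
  | Repeat of nat & code
  | Unless of nat & code.

Fixpoint len (c : code) : nat :=
  match c with
  | Block s => size s
  | Seq c d => len c + len d
  | Repeat _ c => (len c).+1
  | Unless _ c => (len c).+1
  end.

(** Jump targets are absolute, so [b] carries the address at which the code will be placed. *)
Fixpoint compile (b : nat) (c : code) : seq instr :=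
  match c with
  | Block s => s
  | Seq c d => compile b c ++ compile (b + len c) d
  | Repeat r c => rcons (compile b c) (RJump r b)
  | Unless r c => RJump r (b + (len c).+1) :: compile b.+1 c
  end.

Lemma size_compile b c : size (compile b c) = len c.
Proof.
elim: c b => //= [c IHc d IHd|r c IH|r c IH] b.
- by rewrite size_cat IHc IHd.
- by rewrite size_rcons IH.
- by rewrite IH.
Qed.

(** Quantifying over the surrounding program [p1], [p2] is what lets executions of fragments be
    composed. *)
Definition runs (c : code) X (t : nat) X' : Prop :=
  forall p1 p2, iter t (ram_step (p1 ++ compile (size p1) c ++ p2) x)
                  (size p1, X) = (size p1 + len c, X').

Lemma onth_mid (p1 : seq instr) i p2 : onth (p1 ++ i :: p2) (size p1) = Some i.
Proof. by rewrite onthE map_cat nth_cat size_map ltnn subnn. Qed.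

Lemma runs_block s X : all (predC is_jump) s ->
  runs (Block s) X (size s) (foldl effect X s).
Proof.
elim: s X => [|i s IH] X /= => [_ p1 p2|/andP[ni /IH{}IH] p1 p2].
  by rewrite addn0.
rewrite -[LHS]/(iter (size s).+1 _ _) iterSr.
have -> : ram_step (p1 ++ (i :: s) ++ p2) x (size p1, X)
          = ((size p1).+1, effect X i).
  by rewrite /ram_step cat_cons onth_mid; case: i ni.
have := IH (effect X i) (rcons p1 i) p2.
by rewrite size_rcons /= cat_rcons => ->; rewrite addSnnS.
Qed.

Lemma runs_seq c d X1 t X2 u X3 :
  runs c X1 t X2 -> runs d X2 u X3 -> runs (Seq c d) X1 (u + t) X3.
Proof.
move=> rc rd p1 p2 /=; rewrite iterD -catA rc.
have := rd (p1 ++ compile (size p1) c) p2.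
by rewrite -catA size_cat size_compile => ->; rewrite addnA.
Qed.

Lemma ram_step_jump p1 p2 r l X :
  ram_step (p1 ++ RJump r l :: p2) x (size p1, X)
  = (if 0 < X r then l else (size p1).+1, X).
Proof. by rewrite /ram_step onth_mid. Qed.

(** A total-correctness triple with a time bound. *)
Definition hoare P (c : code) (tmax : nat) Q : Prop :=
  forall X, P X -> exists t X', [/\ t <= tmax, runs c X t X' & Q X'].

Lemma hoare_block P s Q : all (predC is_jump) s ->
  (forall X, P X -> Q (foldl effect X s)) -> hoare P (Block s) (size s) Q.
Proof.
move=> sj PQ X PX; exists (size s), (foldl effect X s).
by split=> //; [exact: runs_block|exact: PQ].
Qed.

Lemma hoare_seq P Q S c d t u :
  hoare P c t Q -> hoare Q d u S -> hoare P (Seq c d) (t + u) S.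
Proof.
move=> hc hd X /hc[tc [Y [tct rc /hd[td [Z [tdu rd SZ]]]]]].
exists (td + tc), Z; split=> //; first by rewrite addnC leq_add.
exact: runs_seq rc rd.
Qed.

Lemma hoare_unless P Q r c t :
  (forall X, P X -> 0 < X r -> Q X) ->
  hoare (fun X => P X /\ X r = 0) c t Q -> hoare P (Unless r c) t.+1 Q.
Proof.
move=> PQ hc X PX; have [Xr|] := ltnP 0 (X r).
  exists 1, X; split=> //; last exact: PQ.
  by move=> p1 p2 /=; rewrite ram_step_jump Xr.
rewrite leqn0 => /eqP Xr; have [u [Y [ut rY QY]]] := hc X (conj PX Xr).
exists u.+1, Y; split=> // p1 p2 /=.
rewrite -[LHS]/(iter u.+1 _ _) iterSr ram_step_jump Xr ltnn.
have := rY (rcons p1 (RJump r (size p1 + (len c).+1))) p2.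
by rewrite size_rcons cat_rcons => ->; rewrite addSnnS.
Qed.

(** Induction on the number [d] of iterations left after the current one. The test comes after the
    body, so at least one iteration runs, and each costs one extra step for the jump. *)
Lemma hoare_repeat (Inv : nat -> (nat -> nat) -> Prop) r c m t : 0 < m ->
  (forall j, j < m ->
     hoare (Inv j) c t (fun X => Inv j.+1 X /\ X r = m - j.+1)) ->
  hoare (Inv 0) (Repeat r c) (m * t.+1) (Inv m).
Proof.
move=> m0 hc.
suff step d j : j + d.+1 = m -> hoare (Inv j) (Repeat r c) (d.+1 * t.+1) (Inv m).
  by case: m m0 {hc} step => // m _ step; apply: step.
elim: d j => [|d IH] j jm X IX.
  have [|u [Y [ut rY [IY Yr]]]] := hc j _ X IX; first by lia.
  exists u.+1, Y; split; rewrite ?mul1n //; last by rewrite -jm addn1.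
  move=> p1 p2; rewrite iterS /= cat_rcons rY.
  have := ram_step_jump (p1 ++ compile (size p1) c) p2 r (size p1) Y.
  rewrite -catA size_cat size_compile => ->.
  by rewrite Yr (_ : m - j.+1 = 0) ?addnS //; lia.
have [|u [Y [ut rY [IY Yr]]]] := hc j _ X IX; first by lia.
have [|w [Z [wt rZ IZ]]] := IH j.+1 _ Y IY; first by lia.
exists (w + u.+1), Z; split=> //; first by rewrite mulSn; lia.
move=> p1 p2; have := rZ p1 p2; rewrite iterD iterS /= cat_rcons rY => rZ'.
have := ram_step_jump (p1 ++ compile (size p1) c) p2 r (size p1) Y.
rewrite -catA size_cat size_compile => ->.
rewrite (_ : 0 < Y r) ?rZ' //; lia.
Qed.

Lemma hoare_weak P P' c t t' Q Q' : (forall X, P' X -> P X) -> t <= t' ->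
  (forall X, Q X -> Q' X) -> hoare P c t Q -> hoare P' c t' Q'.
Proof.
move=> PP tt QQ h X /PP/h[u [Y [ut rY QY]]]; exists u, Y; split=> //.
  exact: leq_trans tt.
exact: QQ.
Qed.

Lemma runs_outputs c t X' : runs c (fun=> 0) t X' ->
  ram_outputs (compile 0 c) x t (X' 0).
Proof.
move=> /(_ [::] [::]); rewrite /= cats0 add0n /ram_outputs => ->.
by rewrite size_compile.
Qed.

End StructuredPrograms.

(** * Symbolic execution of straight-line blocks *)

Section SymbolicExecution.
Local Open Scope nat_scope.
Variable x : seq nat.
Implicit Types (e : seq (nat * nat)) (X : nat -> nat).

Fixpoint get e r : option nat :=
  if e is (k, a) :: e' then if eqn r k then Some a else get e' r else None.

(** An environment is a partial description of the registers; earlier entries shadow later ones, so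
    an assignment is recorded by consing. *)
Definition holds e X : Prop := forall r a, get e r = Some a -> X r = a.

Definition get2 e j k (f : nat -> nat -> nat) : option nat :=
  if get e j is Some a then if get e k is Some b then Some (f a b) else None
  else None.

Definition sym_step (oe : option (seq (nat * nat))) (c : instr) :=
  if oe is Some e then
    match c with
    | RConst i a => Some ((i, a) :: e)
    | RAdd i j k => if get2 e j k addn is Some a then Some ((i, a) :: e) else None
    | RSub i j k => if get2 e j k subn is Some a then Some ((i, a) :: e) else None
    | RInput i j =>
        if get e j is Some a then Some ((i, nth 0 x a) :: e) else None
    | _ => None
    end
  else None.

Definition sym_run e (s : seq instr) := foldl sym_step (Some e) s.

Lemma holds_upd e X i a : holds e X -> holds ((i, a) :: e) (upd X i a).
Proof.
move=> eX r b; rewrite /= /upd -/(eqn r i) eqnE; case: eqP => [_ [->]//|_].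
exact: eX.
Qed.

Lemma get2_holds e X j k f a : holds e X -> get2 e j k f = Some a ->
  a = f (X j) (X k).
Proof.
rewrite /get2 => eX.
case gj: (get e j) => [u|//]; case gk: (get e k) => [w|//] [<-].
by rewrite (eX _ _ gj) (eX _ _ gk).
Qed.

Lemma sym_step_ok e X c e' : holds e X -> sym_step (Some e) c = Some e' ->
  holds e' (effect x X c) /\ ~~ is_jump c.
Proof.
case: c => //= [i a|i j k|i j k|i j] eX.
- by case=> <-; split=> //; exact: holds_upd.
- case g: get2 => [b|//] [<-]; rewrite -(get2_holds eX g).
  by split=> //; exact: holds_upd.
- case g: get2 => [b|//] [<-]; rewrite -(get2_holds eX g).
  by split=> //; exact: holds_upd.
- case g: get => [b|//] [<-]; rewrite (eX _ _ g).
  by split=> //; exact: holds_upd.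
Qed.

Lemma sym_run_ok e s e' : sym_run e s = Some e' ->
  hoare x (holds e) (Block s) (size s) (holds e').
Proof.
have none u : foldl sym_step None u = None by elim: u.
move=> run; suff : all (predC is_jump) s /\
    forall X, holds e X -> holds e' (foldl (effect x) X s).
  by case=> sj h; exact: hoare_block.
elim: s e run => [|c s IH] e; first by case=> <-.
rewrite /sym_run -[foldl _ _ _]/(foldl sym_step (sym_step (Some e) c) s).
case E: (sym_step (Some e) c) => [e1|]; last by rewrite none.
rewrite -/(sym_run e1 s) => /IH[sj h]; split.
  apply/andP; split=> //.
  (* [sym_step_ok] needs some register file that satisfies [e] before it can tell that [c] is no
     jump; unlisted registers get 0. *)
  pose X r := odflt 0 (get e r).
  have eX : holds e X by move=> r a; rewrite /X => ->.
  by have [] := sym_step_ok eX E.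
by move=> X eX; apply: h; have [] := sym_step_ok eX E.
Qed.

Fixpoint subenv e e' : Prop :=
  if e is (r, a) :: f then get e' r = Some a /\ subenv f e' else True.

Lemma subenv_holds e e' X : subenv e e' -> holds e' X -> holds e X.
Proof.
move=> ee' e'X r a; elim: e ee' => //= -[k b] e IH [gk /IH{}IH].
rewrite eqnE; case: eqP => [-> [<-]|_ //]; exact: e'X.
Qed.

(** By computation, this turns a triple for a block into one arithmetic equation for each register
    listed in [e']. *)
Lemma hoare_sym e s e' :
  (if sym_run e s is Some e1 then subenv e' e1 else False) ->
  hoare x (holds e) (Block s) (size s) (holds e').
Proof.
case E: (sym_run e s) => [e1|//] sub.
apply: hoare_weak (leqnn _) _ (sym_run_ok E) => // X.
exact: subenv_holds.
Qed.

Lemma hoare_repeat_sym (Inv : nat -> seq (nat * nat)) r c m t : 0 < m ->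
  (forall j, get (Inv j) r = Some (m - j)) ->
  (forall j, j < m -> hoare x (holds (Inv j)) c t (holds (Inv j.+1))) ->
  hoare x (holds (Inv 0)) (Repeat r c) (m * t.+1) (holds (Inv m)).
Proof.
move=> m0 hr hc; apply: (hoare_repeat (Inv := fun j => holds (Inv j))) => // j jm.
apply: hoare_weak (leqnn _) _ (hc j jm) => // X h; split=> //.
exact: h (hr _).
Qed.

End SymbolicExecution.

(** * The greedy program and its correctness *)

Section GreedyProgram.
Local Open Scope nat_scope.

(* Register 0 holds the best row so far and 7 its score; 1: N, 2: the constant
   1, 3: N ^ 2 + 1 (the address of the indicator of R), 20: the constant 0;
   4, 8, 13: remaining iterations of the loops over the rows i, the columns v,
   and the rows k against which v is tested; 5: i; 6, 9, 10, 14, 15, 16: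
   addresses of A i 0, A i v, A 0 v, A k v, R k, y k; 17: number of mismatches
   of v; 11, 12: number of candidates v with A i v = 1 and with A i v = 0. *)
Definition test_row := Block
  [:: RInput 18 14; RInput 19 16; RSub 21 18 19; RSub 22 19 18; RAdd 21 21 22;
      RInput 18 15; RSub 18 2 18; RSub 21 21 18; RAdd 17 17 21;
      RAdd 14 14 1; RAdd 15 15 2; RAdd 16 16 2; RSub 13 13 2].

Definition test_column :=
  Seq (Block [:: RAdd 13 1 20; RAdd 14 10 20; RAdd 15 3 20; RAdd 16 3 1;
                 RConst 17 0])
  (Seq (Repeat 13 test_row)
  (Block [:: RSub 17 2 17; RInput 18 9; RAdd 19 17 18; RSub 19 19 2;
             RAdd 11 11 19; RSub 19 17 18; RAdd 12 12 19;
             RAdd 9 9 2; RAdd 10 10 2; RSub 8 8 2])).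

Definition score_row :=
  Seq (Block [:: RAdd 8 1 20; RAdd 9 6 20; RConst 10 1; RConst 11 0;
                 RConst 12 0])
  (Seq (Repeat 8 test_column)
  (Seq (Block [:: RSub 18 11 12; RSub 18 11 18; RAdd 19 7 2; RSub 19 19 18])
  (Seq (Unless 19 (Block [:: RAdd 7 18 20; RAdd 0 5 20]))
  (Block [:: RAdd 5 5 2; RAdd 6 6 1; RSub 4 4 2])))).

(** The first loop obtains N ^ 2 + 1 by repeated addition, as the machine cannot multiply. Both
    [RAdd 4 1 0] copy N, because register 0 is still 0 there. *)
Definition greedy_code :=
  Seq (Block [:: RInput 1 0; RConst 2 1; RConst 3 1; RAdd 4 1 0])
  (Seq (Repeat 4 (Block [:: RAdd 3 3 1; RSub 4 4 2]))
  (Seq (Block [:: RAdd 4 1 0; RConst 5 0; RConst 6 1; RConst 7 0])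
  (Repeat 4 score_row))).

Variables (x : seq nat) (N : nat).
Local Notation a k v := (nth 0 x (1 + k * N + v)).
Local Notation rho k := (nth 0 x (1 + N * N + k)).
Local Notation obs k := (nth 0 x (1 + N * N + N + k)).

(** The two truncated differences add up to the exclusive or of the bits; subtracting [1 - rho k]
    discards the rows outside R. *)
Definition mismatches j v :=
  \sum_(0 <= k < j) (((a k v - obs k) + (obs k - a k v)) - (1 - rho k)).

Definition alive v := 1 - mismatches N v.

(** On bits, truncated [u + w - 1] is the conjunction of u and w, and [u - w] in [zeros_upto] is u
    and not w. *)
Definition ones_upto j i := \sum_(0 <= v < j) (alive v + a i v - 1).

Definition zeros_upto j i := \sum_(0 <= v < j) (alive v - a i v).

(** Truncated [u - (u - w)] is the minimum of u and w: the number of candidates removed by row i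
    under the less favourable answer. *)
Definition row_score i :=
  ones_upto N i - (ones_upto N i - zeros_upto N i).

Fixpoint best_upto j : nat * nat :=
  if j is i.+1 then
    if (best_upto i).2 < row_score i then (i, row_score i) else best_upto i
  else (0, 0).

Hypotheses (N0 : 0 < N) (xN : nth 0 x 0 = N).

Definition globals := [:: (1, N); (2, 1); (3, 1 + N * N); (20, 0)].

(** The invariants of the three nested loops; each extends the one of the enclosing loop. *)
Definition row_regs i := globals ++
  [:: (4, N - i); (5, i); (6, 1 + i * N); (7, (best_upto i).2);
      (0, (best_upto i).1)].

Definition col_regs i v := row_regs i ++
  [:: (8, N - v); (9, 1 + i * N + v); (10, 1 + v);
      (11, ones_upto v i); (12, zeros_upto v i)].

Definition cell_regs i v k := col_regs i v ++
  [:: (13, N - k); (14, 1 + k * N + v); (15, 1 + N * N + k);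
      (16, 1 + N * N + N + k); (17, mismatches k v)].

Ltac symbolic_execution :=
  apply: hoare_sym;
  cbv [sym_run sym_step get get2 foldl subenv cat globals row_regs col_regs
       cell_regs eqn];
  do !split; congr Some.

Lemma test_row_ok i v k : k < N ->
  hoare x (holds (cell_regs i v k)) test_row 13 (holds (cell_regs i v k.+1)).
Proof.
move=> kN; have mS : mismatches k.+1 v = mismatches k v
    + (((a k v - obs k) + (obs k - a k v)) - (1 - rho k)).
  by rewrite /mismatches big_nat_recr.
symbolic_execution; rewrite ?mS; lia.
Qed.

Lemma test_column_ok i v : v < N ->
  hoare x (holds (col_regs i v)) test_column (15 + N * 14)
    (holds (col_regs i v.+1)).
Proof.
move=> vN; rewrite (_ : 15 + N * 14 = 5 + (N * 14 + 10)); last by lia.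
have m0 : mismatches 0 v = 0 by rewrite /mismatches big_nil.
have oS : ones_upto v.+1 i = ones_upto v i + (alive v + a i v - 1).
  by rewrite /ones_upto big_nat_recr.
have zS : zeros_upto v.+1 i = zeros_upto v i + (alive v - a i v).
  by rewrite /zeros_upto big_nat_recr.
apply: (@hoare_seq _ _ (holds (cell_regs i v 0))).
  by symbolic_execution; rewrite ?m0; lia.
apply: hoare_seq.
  apply: (@hoare_repeat_sym x (fun k => cell_regs i v k) 13 _ N) => // k kN.
  exact: test_row_ok.
by symbolic_execution; rewrite ?oS ?zS /alive; lia.
Qed.

Lemma score_row_ok i : i < N ->
  hoare x (holds (row_regs i)) score_row (15 + N * (16 + N * 14))
    (holds (row_regs i.+1)).
Proof.
move=> iN.
rewrite (_ : 15 + _ = 5 + (N * (15 + N * 14).+1 + (4 + (3 + 3)))); last by lia.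
have o0 : ones_upto 0 i = 0 by rewrite /ones_upto big_nil.
have z0 : zeros_upto 0 i = 0 by rewrite /zeros_upto big_nil.
apply: (@hoare_seq _ _ (holds (col_regs i 0))).
  by symbolic_execution; rewrite ?o0 ?z0; lia.
apply: hoare_seq.
  apply: (@hoare_repeat_sym x (fun v => col_regs i v) 8 _ N) => // v vN.
  exact: test_column_ok.
(* Register 19 vanishes exactly when the new score is strictly larger than the best one, which is
   when [Unless] runs its body. *)
apply: (@hoare_seq _ _ (holds (row_regs i ++
    [:: (18, row_score i); (19, (best_upto i).2 + 1 - row_score i)]))).
  by symbolic_execution; rewrite /row_score; lia.
(* The state in which the best row is already updated but the loop registers 4, 5 and 6 are not. *)
pose next := globals ++ [:: (4, N - i); (5, i); (6, 1 + i * N);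
  (7, (best_upto i.+1).2); (0, (best_upto i.+1).1)].
apply: (@hoare_seq _ _ (holds next)); last first.
  by rewrite /next; symbolic_execution; lia.
have bS : best_upto i.+1 = if (best_upto i).2 < row_score i
  then (i, row_score i) else best_upto i by [].
apply: hoare_unless => [X h|].
  rewrite (h 19 _ erefl) => sc; apply: subenv_holds h.
  by rewrite /next bS ifF; [do !split|lia].
have [lt_s|ge_s] := ltnP (best_upto i).2 (row_score i); last first.
  by move=> X [h]; rewrite (h 19 _ erefl); lia.
apply: (hoare_weak _ (leqnn 2)); last first.
- apply: (@hoare_sym _ (row_regs i ++ [:: (18, row_score i)]) _ next).
  rewrite /next bS lt_s.
  cbv [sym_run sym_step get get2 foldl subenv cat globals row_regs eqn].
  by do !split; congr Some => /=; lia.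
- by [].
- by move=> X [h _]; apply: subenv_holds h; do !split.
Qed.

Lemma greedy_code_ok : exists2 t, t <= 100 * N ^ 100 &
  ram_outputs (compile 0 greedy_code) x t (best_upto N).1.
Proof.
pose e0 := [:: (0, 0); (20, 0)].
pose e1 j := [:: (0, 0); (1, N); (2, 1); (3, 1 + j * N); (20, 0); (4, N - j)].
have h : hoare x (holds e0) greedy_code
    (4 + (N * 3 + (4 + N * (15 + N * (16 + N * 14)).+1)))
    (holds (row_regs N)).
  apply: (@hoare_seq _ _ (holds (e1 0))).
    by rewrite /e0 /e1; symbolic_execution; rewrite ?xN; lia.
  apply: hoare_seq.
    apply: (@hoare_repeat_sym x e1 4 _ N) => // j jN.
    by rewrite /e1; symbolic_execution; lia.
  apply: (@hoare_seq _ _ (holds (row_regs 0))).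
    rewrite /e1; symbolic_execution; rewrite ?[best_upto 0]/(0, 0) /=; lia.
  apply: (@hoare_repeat_sym x row_regs 4 _ N) => // i iN.
  exact: score_row_ok.
have [|t [X [tle rX hX]]] := h (fun=> 0).
  by move=> r a /=; do 2 (case: eqn => [[]//|]).
(* The running time is cubic; 100 is both coefficient and exponent because [polynomial_time] has a
   single constant for the two. *)
exists t; last by rewrite -(hX 0 _ erefl); exact: runs_outputs.
apply: (leq_trans tle); apply: (@leq_trans (100 * N ^ 3)); last first.
  by rewrite leq_mul2l leq_pexp2l.
rewrite !expnS expn0; nia.
Qed.

End GreedyProgram.

(** * Probability estimates for random matrices *)

Section RandomMatrix.
Variables (R : realType) (N : nat) (q : R).
Hypothesis hq : 0 < q < 1.
Implicit Types (A : 'M[bool]_N) (E F : 'M[bool]_N -> Prop).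
Local Notation Pr := (@random_matrix_prob R N q).

Definition bern (b : bool) : R := if b then q else 1 - q.

Lemma bern_gt0 b : 0 < bern b.
Proof. by case: b; rewrite /bern; move/andP: hq => [? ?]; lra. Qed.

Lemma bern_ge0 b : 0 <= bern b. Proof. exact/ltW/bern_gt0. Qed.

Lemma bernD b : bern b + bern (~~ b) = 1.
Proof. by case: b; rewrite /bern /=; lra. Qed.

Definition mx_weight A : R := \prod_(i < N) \prod_(j < N) bern (A i j).

Lemma mx_weight_ge0 A : 0 <= mx_weight A.
Proof. by do 2 (apply: prodr_ge0 => ? _); exact: bern_ge0. Qed.

Lemma prob_le_expect E (F : 'M[bool]_N -> R) :
  (forall A, 0 <= F A) -> (forall A, E A -> 1 <= F A) ->
  Pr E <= \sum_A F A * mx_weight A.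
Proof.
move=> F0 F1; rewrite /random_matrix_prob big_mkcond.
apply: ler_sum => A _; case: asboolP => [/F1 FA|_].
  by rewrite -[leLHS]mul1r ler_wpM2r // mx_weight_ge0.
by rewrite mulr_ge0 // mx_weight_ge0.
Qed.

Lemma prob_mono E F : (forall A, E A -> F A) -> Pr E <= Pr F.
Proof.
move=> EF; rewrite /random_matrix_prob big_mkcond [leRHS]big_mkcond.
apply: ler_sum => A _; case: asboolP => [/EF FA|_]; first by rewrite asboolT.
by case: asboolP => // _; exact: mx_weight_ge0.
Qed.

Lemma prob_or E F : Pr (fun A => E A \/ F A) <= Pr E + Pr F.
Proof.
rewrite /random_matrix_prob big_mkcond [X in _ <= X + _]big_mkcond.
rewrite [X in _ <= _ + X]big_mkcond -big_split /=.
apply: ler_sum => A _; have := mx_weight_ge0 A; rewrite /mx_weight /bern.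
case: asboolP => [[EA|FA] w0|_ w0].
- by rewrite (asboolT EA) lerDl; case: ifP.
- by rewrite (asboolT FA) lerDr; case: ifP.
- by rewrite addr_ge0 //; case: ifP.
Qed.

Lemma prob_exists (I : finType) (P : pred I) (E : I -> 'M[bool]_N -> Prop) :
  Pr (fun A => exists2 i, P i & E i A) <= \sum_(i | P i) Pr (E i).
Proof.
apply: (@le_trans _ _ (\sum_A (\sum_(i | P i) (`[< E i A >])%:R) * mx_weight A)).
  apply: prob_le_expect => [A|A [i Pi EiA]]; first exact: sumr_ge0.
  by rewrite (bigD1 i) //= asboolT // lerDl sumr_ge0.
rewrite le_eqVlt; apply/orP; left; apply/eqP.
under eq_bigr do rewrite big_distrl /=.
rewrite exchange_big /=; apply: eq_bigr => i _.
rewrite /random_matrix_prob [RHS]big_mkcond; apply: eq_bigr => A _.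
by case: asboolP; rewrite ?mul1r ?mul0r.
Qed.

Definition vec_weight (c : {ffun 'I_N -> bool}) : R := \prod_(i < N) bern (c i).

Lemma vec_weight_ge0 c : 0 <= vec_weight c.
Proof. by apply: prodr_ge0 => ? _; exact: bern_ge0. Qed.

Lemma sum_vec_prod (F : 'I_N -> bool -> R) :
  \sum_(c : {ffun 'I_N -> bool}) \prod_(i < N) F i (c i)
  = \prod_(i < N) (F i true + F i false).
Proof.
by rewrite -bigA_distr_bigA; apply: eq_bigr => i _; rewrite big_bool.
Qed.

Definition col_vec A v : {ffun 'I_N -> bool} := [ffun i => A i v].
Definition row_vec A i : {ffun 'I_N -> bool} := [ffun j => A i j].

(** Independence of the columns: a matrix is reindexed as a family of columns, and the sum over
    families of a product distributes. *)
Lemma expect_cols (F : 'I_N -> {ffun 'I_N -> bool} -> R) :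
  \sum_A (\prod_v F v (col_vec A v)) * mx_weight A
  = \prod_v \sum_c F v c * vec_weight c.
Proof.
rewrite bigA_distr_bigA /=.
pose f A := [ffun v => col_vec A v].
pose g (h : {ffun 'I_N -> {ffun 'I_N -> bool}}) := (\matrix_(i, j) h j i)%R.
rewrite (reindex f) /=; last first.
  apply: onW_bij; exists g => [A|h].
    by apply/matrixP=> i j; rewrite mxE !ffunE.
  by apply/ffunP=> v; apply/ffunP=> i; rewrite !ffunE mxE.
apply: eq_bigr => A _; rewrite big_split /=; congr (_ * _).
  by apply: eq_bigr => v _; rewrite ffunE.
rewrite /mx_weight exchange_big /=; apply: eq_bigr => v _.
by apply: eq_bigr => i _; rewrite !ffunE.
Qed.

Lemma expect_rows (F : 'I_N -> {ffun 'I_N -> bool} -> R) :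
  \sum_A (\prod_i F i (row_vec A i)) * mx_weight A
  = \prod_i \sum_c F i c * vec_weight c.
Proof.
rewrite bigA_distr_bigA /=.
pose f A := [ffun v => row_vec A v].
pose g (h : {ffun 'I_N -> {ffun 'I_N -> bool}}) := (\matrix_(i, j) h i j)%R.
rewrite (reindex f) /=; last first.
  apply: onW_bij; exists g => [A|h].
    by apply/matrixP=> i j; rewrite mxE !ffunE.
  by apply/ffunP=> v; apply/ffunP=> i; rewrite !ffunE mxE.
apply: eq_bigr => A _; rewrite big_split /=; congr (_ * _).
  by apply: eq_bigr => v _; rewrite ffunE.
apply: eq_bigr => v _.
by apply: eq_bigr => i _; rewrite !ffunE.
Qed.

Lemma sum_vec_weight : \sum_c vec_weight c = 1.
Proof.
rewrite (sum_vec_prod (fun=> bern)) big1 // => i _; exact: (bernD true).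
Qed.

Lemma prob_true : Pr (fun=> True) = 1.
Proof.
transitivity (\sum_A (\prod_(v < N) (1 : R)) * mx_weight A).
  by apply: eq_big => [A|A _]; rewrite ?asboolT // big1_eq mul1r.
rewrite (expect_cols (fun _ _ => 1)) big1 // => v _.
by under eq_bigr do rewrite mul1r; exact: sum_vec_weight.
Qed.

Lemma prob_le1 E : Pr E <= 1.
Proof. by rewrite -prob_true; exact: prob_mono. Qed.

Lemma prob_not E : Pr (fun A => ~ E A) = 1 - Pr E.
Proof.
apply/eqP; rewrite eq_sym subr_eq -prob_true addrC; apply/eqP.
rewrite /random_matrix_prob (bigID (fun A => `[< E A >])) /=.
by congr (_ + _); apply: eq_bigl => A; rewrite asboolT ?asbool_neg.
Qed.

(** * Columns that are constant on a set of rows *)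

Section ConstantColumns.
Variables (b : bool) (S : {set 'I_N}).

Lemma vec_constant_prob :
  \sum_(c : {ffun 'I_N -> bool} | [forall i in S, c i == b]) vec_weight c = bern b ^+ #|S|.
Proof.
transitivity (\sum_(c : {ffun 'I_N -> bool}) \prod_i
    ((if i \in S then (c i == b)%:R else 1) * bern (c i))).
  rewrite big_mkcond; apply: eq_bigr => c _; rewrite big_split /=.
  case: (boolP [forall i in S, c i == b]) => [/forall_inP cb|].
    rewrite [X in _ = X * _]big1 ?mul1r // => i _.
    by case: ifP => // /cb ->.
  rewrite negb_forall_in => /exists_inP[i iS cib].
  by rewrite (bigD1 i) //= iS (negbTE cib) !mul0r.
rewrite (sum_vec_prod (fun i x => (if i \in S then (x == b)%:R else 1) * bern x)).
rewrite -prodr_const [RHS]big_mkcond; apply: eq_bigr => i _.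
by case: ifP => _; case: b; rewrite /bern /= ?mul1r ?mul0r ?addr0 ?add0r; lra.
Qed.

Definition constant_cols A := [set v | [forall i in S, A i v == b]]%SET.

(** With at most one constant column there is a [v0] such that the N - 1 independent other columns
    are all non-constant; the factor N is the union bound over [v0], which is arbitrary if no column
    is constant. *)
Lemma few_constant_cols_prob : (0 < N)%N ->
  Pr (fun A => (#|constant_cols A| <= 1)%N)
  <= N%:R * (1 - bern b ^+ #|S|) ^+ N.-1.
Proof.
move=> N0; pose D v0 A := forall v, v != v0 -> v \notin constant_cols A.
apply: (@le_trans _ _ (Pr (fun A => exists2 v0 : 'I_N, true & D v0 A))).
  apply: prob_mono => A.
  rewrite leq_eqVlt ltnS leqn0 => /orP[/cards1P[v0 eqA]|/eqP/cards0_eq eqA].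
    by exists v0 => // v vv0; rewrite eqA inE.
  by exists (Ordinal N0) => // v _; rewrite eqA inE.
apply: (le_trans (prob_exists _ _)).
apply: (@le_trans _ _ (\sum_(v0 < N) (1 - bern b ^+ #|S|) ^+ N.-1)); last first.
  by rewrite sumr_const card_ord mulr_natl.
apply: ler_sum => v0 _.
pose F (v : 'I_N) (c : {ffun 'I_N -> bool}) : R :=
  if v == v0 then 1 else (~~ [forall i in S, c i == b])%:R.
apply: (@le_trans _ _ (\sum_A (\prod_v F v (col_vec A v)) * mx_weight A)).
  apply: prob_le_expect => A => [|DA].
    by apply: prodr_ge0 => v _; rewrite /F; case: ifP.
  rewrite big1 // => v _; rewrite /F; case: ifPn => // /DA.
  rewrite inE => nc; rewrite (_ : ~~ _) //; apply: contra nc.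
  by move=> /forall_inP h; apply/forall_inP => i /h; rewrite ffunE.
rewrite expect_cols (bigD1 v0) //= {1}/F eqxx.
under eq_bigr do rewrite mul1r.
rewrite sum_vec_weight mul1r.
rewrite (eq_bigr (fun=> 1 - bern b ^+ #|S|)) => [|v vv0].
  by rewrite prodr_const cardC1 card_ord.
rewrite -vec_constant_prob -sum_vec_weight.
rewrite [X in _ = X - _](bigID
  [pred c : {ffun 'I_N -> bool} | [forall i in S, c i == b]]) /=.
rewrite [X in _ = X]addrAC subrr add0r [RHS]big_mkcond; apply: eq_bigr => c _.
by rewrite /F (negbTE vv0); case: ifP; rewrite ?mul1r ?mul0r.
Qed.

End ConstantColumns.

(** * Collisions among columns restricted to a set of rows *)

Section RestrictedColumns.
Variable S : {set 'I_N}.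

Definition restrict (c : {ffun 'I_N -> bool}) : {ffun 'I_N -> bool} :=
  [ffun i => (i \in S) && c i].

(** The law of a restricted column: independent bits on S, point mass at [false] elsewhere. *)
Definition restrict_law (x : {ffun 'I_N -> bool}) : R :=
  \prod_i (if i \in S then bern (x i) else (~~ x i)%:R).

Lemma restrict_law_ge0 x : 0 <= restrict_law x.
Proof. by apply: prodr_ge0 => i _; case: ifP => // _; exact: bern_ge0. Qed.

Lemma restrict_lawE x :
  \sum_c (restrict c == x)%:R * vec_weight c = restrict_law x.
Proof.
transitivity (\sum_(c : {ffun 'I_N -> bool}) \prod_i
    ((((i \in S) && c i) == x i)%:R * bern (c i))).
  apply: eq_bigr => c _; rewrite big_split /=; congr (_ * _).
  case: eqP => [<-|/eqP].
    by rewrite big1 // => i _; rewrite ffunE eqxx.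
  move=> cx; have /existsP[i ci] : [exists i, restrict c i != x i].
    apply: contraNT cx; rewrite negb_exists => /forallP h.
    by apply/eqP/ffunP => i; apply/eqP/negPn/h.
  by rewrite (bigD1 i) //= -[(_ && _)](ffunE (fun i => (i \in S) && c i)) (negbTE ci) mul0r.
rewrite (sum_vec_prod (fun i y => (((i \in S) && y) == x i)%:R * bern y)).
apply: eq_bigr => i _; case: (i \in S) => /=; case: (x i);
  by rewrite /bern /= ?mul1r ?mul0r; lra.
Qed.

Lemma sum_restrict_law : \sum_x restrict_law x = 1.
Proof.
rewrite (sum_vec_prod (fun i y => if i \in S then bern y else (~~ y)%:R)).
by rewrite big1 // => i _; case: ifP => _ /=; rewrite /bern; lra.
Qed.

Lemma sum_restrict_law2 :
  \sum_x restrict_law x ^+ 2 = (q ^+ 2 + (1 - q) ^+ 2) ^+ #|S|.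
Proof.
rewrite -prodr_const [RHS]big_mkcond /=.
under eq_bigr do rewrite -prodrXl.
rewrite (sum_vec_prod (fun i y => (if i \in S then bern y else (~~ y)%:R) ^+ 2)).
by apply: eq_bigr => i _; case: ifP => _ /=; rewrite /bern; lra.
Qed.

Lemma restr_col_eq A u v :
  (restr_col A S u == restr_col A S v)
  = (restrict (col_vec A u) == restrict (col_vec A v)).
Proof.
apply/eqP/eqP => /ffunP h; apply/ffunP => i; have := h i; rewrite !ffunE.
  by case: ifP => //= _ [].
by case: ifP => //= _ ->.
Qed.

(** A union bound over ordered pairs of columns; two independent samples of [restrict_law] agree
    with probability the sum of its squares. *)
Lemma col_collision_prob :
  Pr (fun A => ~ injective (restr_col A S))
  <= N%:R ^+ 2 * (q ^+ 2 + (1 - q) ^+ 2) ^+ #|S|.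
Proof.
apply: (@le_trans _ _ (Pr (fun A => exists2 w : 'I_N * 'I_N, w.1 != w.2 &
    restrict (col_vec A w.1) = restrict (col_vec A w.2)))).
  apply: prob_mono => A; rewrite /injective.
  move=> /existsNP[u /existsNP[v /not_implyP[uv nuv]]].
  exists (u, v); first exact/eqP.
  by apply/eqP; rewrite -restr_col_eq uv.
apply: (le_trans (prob_exists _ _)).
apply: (@le_trans _ _ (\sum_(w : 'I_N * 'I_N) (q ^+ 2 + (1 - q) ^+ 2) ^+ #|S|)); last first.
  by rewrite sumr_const card_prod card_ord -[X in X <= _]mulr_natl natrM [N%:R ^+ 2]expr2.
rewrite big_mkcond; apply: ler_sum => -[u v] _ /=; case: ifP => uv; last first.
  by rewrite exprn_ge0 // addr_ge0 // sqr_ge0.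
pose F x (w : 'I_N) c : R := if (w == u) || (w == v) then (restrict c == x)%:R else 1.
apply: (@le_trans _ _ (\sum_A (\sum_x \prod_w F x w (col_vec A w)) * mx_weight A)).
  apply: prob_le_expect => A => [|uvA].
    by apply: sumr_ge0 => x _; apply: prodr_ge0 => w _; rewrite /F; case: ifP.
  rewrite (bigD1 (restrict (col_vec A u))) //= big1 => [|w _]; last first.
    by rewrite /F; case: ifP => // /orP[]/eqP ->; rewrite -?uvA eqxx.
  rewrite lerDl; apply: sumr_ge0 => x _; apply: prodr_ge0 => w _.
  by rewrite /F; case: ifP.
under eq_bigr do rewrite big_distrl /=.
rewrite exchange_big -sum_restrict_law2 /=.
apply: ler_sum => x _; rewrite expect_cols (bigD1 u) //= (bigD1 v) /=; last first.
  by rewrite eq_sym uv.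
under eq_bigr do rewrite /F eqxx /=.
rewrite restrict_lawE; under eq_bigr do rewrite /F eqxx orbT /=.
rewrite restrict_lawE big1 ?mulr1 ?expr2 // => w /andP[wu wv].
by rewrite -sum_vec_weight; apply: eq_bigr => c _; rewrite /F (negbTE wu) (negbTE wv) mul1r.
Qed.

(** A union bound over the injective families [f] of values of the restricted columns, in the form
    that [birthday] estimates. *)
Lemma distinct_cols_prob_le :
  Pr (fun A => injective (restr_col A S))
  <= \sum_(f : {ffun 'I_N -> {ffun 'I_N -> bool}} | injectiveb f)
       \prod_v restrict_law (f v).
Proof.
pose F (f : {ffun 'I_N -> {ffun 'I_N -> bool}}) (v : 'I_N) c : R :=
  (restrict c == f v)%:R.
apply: (@le_trans _ _ (\sum_A (\sum_(f : {ffun 'I_N -> {ffun 'I_N -> bool}} | injectiveb f)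
    \prod_w F f w (col_vec A w)) * mx_weight A)).
  apply: prob_le_expect => A => [|injA].
    by apply: sumr_ge0 => f _; apply: prodr_ge0.
  rewrite (bigD1 [ffun v => restrict (col_vec A v)]) /=; last first.
    apply/injectiveP => u v; rewrite !ffunE => /eqP.
    by rewrite -restr_col_eq => /eqP/injA.
  rewrite big1 => [|v _]; last by rewrite /F ffunE eqxx.
  by rewrite lerDl; apply: sumr_ge0 => f _; apply: prodr_ge0.
under eq_bigr do rewrite big_distrl /=.
rewrite exchange_big /=; apply: ler_sum => f _; rewrite expect_cols.
by under eq_bigr do rewrite restrict_lawE.
Qed.

End RestrictedColumns.

End RandomMatrix.

(** * A birthday bound for an arbitrary law *)

Section Birthday.
Variable R : realType.

(** A weak Stirling bound, m! <= e m (m / e)^m for m = n + 1. The induction step rests on (1 - 1 /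
    (n + 2))^(n + 2) <= 1 / e. *)
Lemma fact_le_expR (n : nat) :
  n.+1`!%:R * expR n.+1%:R <= expR 1 * n.+1%:R ^+ n.+2 :> R.
Proof.
elim: n => [|n IH]; first by rewrite expr1n mul1r mulr1.
have e1 : expR 1 * n.+1%:R ^+ n.+2 <= n.+2%:R ^+ n.+2 :> R.
  have : (n.+1%:R / n.+2%:R) ^+ n.+2 <= expR (- 1) :> R.
    have -> : expR (-1) = expR (- n.+2%:R^-1) ^+ n.+2 :> R.
      by rewrite -expRM_natl mulrN divff.
    apply: lerXn2r; rewrite ?nnegrE ?expR_ge0 ?divr_ge0 //.
    apply: le_trans (expR_ge1Dx _).
    by rewrite ler_pdivrMr // mulrBl mulVf // mul1r -[n.+2%:R]natr1 addrK.
  rewrite expr_div_n ler_pdivrMr ?exprn_gt0 // expRN => h.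
  by rewrite -ler_pdivlMl ?expR_gt0.
rewrite factS natrM -[in expR _%:R]natr1 expRD.
have -> : n.+2%:R * n.+1`!%:R * (expR n.+1%:R * expR 1)
  = n.+2%:R * expR 1 * (n.+1`!%:R * expR n.+1%:R) :> R by ring.
apply: (@le_trans _ _ (n.+2%:R * expR 1 * (expR 1 * n.+1%:R ^+ n.+2))).
  by rewrite ler_wpM2l // mulr_ge0 ?expR_ge0.
rewrite [leRHS](_ : _ = n.+2%:R * expR 1 * n.+2%:R ^+ n.+2).
  by rewrite ler_wpM2l // mulr_ge0 ?expR_ge0.
by rewrite exprS; ring.
Qed.

(* ln (1 + x) = 2 ln s <= 2 (s - 1) with s := sqrt (1 + x). *)
Lemma oneD_le_expR (x : R) : 0 <= x ->
  1 + x <= expR (x - x ^+ 2 / (4 * (1 + x))).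
Proof.
move=> x0; pose s := Num.sqrt (1 + x).
have s2 : s ^+ 2 = 1 + x by rewrite sqr_sqrtr //; lra.
have s0 : 0 <= s by exact: sqrtr_ge0.
have s1 : 1 <= s by nra.
rewrite -{1}s2; apply: (@le_trans _ _ (expR (2%:R * (s - 1)))).
  rewrite expRM_natl; apply: lerXn2r; rewrite ?nnegrE ?expR_ge0 //.
  by apply: le_trans (expR_ge1Dx _); lra.
rewrite ler_expR -s2; have -> : x = s ^+ 2 - 1 by lra.
have -> : (s ^+ 2 - 1) ^+ 2 / (4 * s ^+ 2) = (s - 1) ^+ 2 * (((s + 1) / (2 * s)) ^+ 2).
  by field; lra.
have : ((s + 1) / (2 * s)) ^+ 2 <= 1.
  rewrite expr_le1 //; last by rewrite divr_ge0; lra.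
  by rewrite ler_pdivrMr; lra.
have := sqr_ge0 (s - 1); nra.
Qed.

Variables (T : finType) (n : nat) (p : T -> R).
Hypothesis p_ge0 : forall x, 0 <= p x.

(** Group the injections by their image: a set of n elements is the image of at most n! of them. *)
Lemma sum_injections_le :
  \sum_(f : {ffun 'I_n -> T} | injectiveb f) \prod_v p (f v)
  <= n`!%:R * \sum_(J : {set T} | #|J| == n) \prod_(x in J) p x.
Proof.
rewrite (partition_big (fun f : {ffun 'I_n -> T} => [set f v | v : 'I_n]%SET)
          (fun J => #|J| == n)) /=; last first.
  by move=> f /injectiveP injf; rewrite card_imset // card_ord.
rewrite big_distrr /=; apply: ler_sum => J /eqP Jn.
rewrite (eq_bigr (fun=> \prod_(x in J) p x)); last first.
  move=> f /andP[/injectiveP injf /eqP <-].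
  by rewrite big_imset //=; apply: in2W.
rewrite sumr_const -[X in X <= _]mulr_natl ler_wpM2r //.
  by apply: prodr_ge0 => x _.
rewrite ler_nat; have -> : n`! = (#|J| ^_ #|'I_n|)%N by rewrite card_ord Jn ffactnn.
rewrite -(card_inj_ffuns_on _ (mem J)); apply: subset_leq_card.
apply/fintype.subsetP => f; rewrite inE => /andP[injf /eqP fJ]; rewrite inE injf andbT.
by apply/ffun_onP => v; rewrite -fJ; apply: imset_f.
Qed.

(** The left side is the degree n term of the product expanded in z, whose other terms are
    nonnegative. *)
Lemma sum_subsets_le (z : R) : 0 <= z ->
  z ^+ n * \sum_(J : {set T} | #|J| == n) \prod_(x in J) p x
  <= \prod_x (1 + z * p x).
Proof.
move=> z0.
under [leRHS]eq_bigr do rewrite addrC.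
rewrite bigA_distr /= big_distrr /= big_mkcond; apply: ler_sum => J _.
have nn : 0 <= \prod_x (if x \in J then z * p x else 1).
  by apply: prodr_ge0 => x _; case: ifP => // _; rewrite mulr_ge0.
case: ifP => // /eqP Jn; rewrite -Jn -prodr_const -big_split /= big_mkcond.
exact: lexx.
Qed.

(* Bounds n! e_n(p) by n! z^-n prod_x (1 + z p_x) at z = n. *)
Lemma birthday (m : R) : (0 < n)%N -> \sum_x p x = 1 -> 1 <= m ->
  m ^+ 2 = n%:R ^+ 2 * \sum_x p x ^+ 2 ->
  \sum_(f : {ffun 'I_n -> T} | injectiveb f) \prod_v p (f v)
  <= expR 1 * n%:R * expR (- (m / 8)).
Proof.
move=> n0 p1 m1 m2; apply: (le_trans sum_injections_le).
have nR : 0 < n%:R :> R by rewrite ltr0n.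
set e := \sum_(J | _) _.
have h1 : n%:R ^+ n * e <= expR (n%:R - m / 8).
  apply: (le_trans (sum_subsets_le (ltW nR))).
  apply: (@le_trans _ _ (expR (\sum_x (n%:R * p x - (n%:R * p x) ^+ 2 / (4 * (1 + m)))))).
    rewrite expR_sum; apply: ler_prod => x _.
    have y0 : 0 <= n%:R * p x by rewrite mulr_ge0 // ltW.
    rewrite addr_ge0 //=; apply: (le_trans (oneD_le_expR y0)).
    rewrite ler_expR lerD2l lerN2 ler_wpM2l ?sqr_ge0 //.
    rewrite lef_pV2 ?posrE; [|lra|lra].
    (* A single term of the sum of squares already gives (n p_x)^2 <= m^2, so one denominator 4 (1 +
       m) serves all x. *)
    suff : n%:R * p x <= m by lra.
    rewrite -(@ler_pXn2r _ 2) ?nnegrE //; last by lra.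
    rewrite m2 exprMn ler_wpM2l ?sqr_ge0 // (bigD1 x) //= lerDl.
    by apply: sumr_ge0 => y _; exact: sqr_ge0.
  rewrite ler_expR big_split /= -big_distrr /= p1 mulr1 lerD2l.
  rewrite sumrN -big_distrl /= lerN2.
  under eq_bigr do rewrite exprMn.
  (* The quadratic gains add up to m^2 / (4 (1 + m)), which is at least m / 8 as m >= 1. *)
  rewrite -big_distrr /= -m2 ler_pdivlMr; [nra|lra].
have h2 : n`!%:R * expR n%:R <= expR 1 * n%:R ^+ n.+1 :> R.
  by case: n n0 => // k _; exact: fact_le_expR.
have zn : 0 < n%:R ^+ n :> R by rewrite exprn_gt0.
rewrite -(ler_pM2r zn) [leLHS](_ : _ = n`!%:R * (n%:R ^+ n * e)); last by ring.
apply: (@le_trans _ _ (n`!%:R * expR (n%:R - m / 8))).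
  by rewrite ler_wpM2l.
rewrite expRD mulrA [leRHS](_ : _ = expR 1 * n%:R ^+ n.+1 * expR (- (m / 8))).
  by rewrite ler_wpM2r ?expR_ge0.
by rewrite exprS; ring.
Qed.

End Birthday.

(** * Chernoff bounds for the rows *)

Section Chernoff.
Variables (R : realType) (N : nat) (q : R).
Hypothesis hq : 0 < q < 1.
Local Notation Pr := (@random_matrix_prob R N q).

Definition row_count (A : 'M[bool]_N) (T : {set 'I_N}) (b : bool) (i : 'I_N) : nat :=
  #|[set j in T | A i j == b]%SET|.

(** Because e^s (1 - s + s^2) >= (1 + s)(1 - s + s^2) = 1 + s^3. *)
Lemma expR_neg_le (s : R) : 0 <= s -> expR (- s) <= 1 - s + s ^+ 2.
Proof.
move=> s0; rewrite expRN -div1r ler_pdivrMr ?expR_gt0 //.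
have := expR_ge1Dx s; have : 0 <= s ^+ 3 by rewrite exprn_ge0.
have : 0 <= 1 - s + s ^+ 2 by nra.
nra.
Qed.

Lemma vec_count_mgf (T : {set 'I_N}) b (s p : R) : 0 <= s <= 1 -> p <= bern q b ->
  \sum_(c : {ffun 'I_N -> bool})
    expR (- s * #|[set j in T | c j == b]%SET|%:R) * vec_weight q c
  <= expR (- (p * (s - s ^+ 2)) * #|T|%:R).
Proof.
move=> /andP[s0 s1] pb.
pose F (j : 'I_N) (y : bool) : R :=
  (if j \in T then (if y == b then expR (- s) else 1) else 1) * bern q y.
rewrite (eq_bigr (fun c : {ffun 'I_N -> bool} => \prod_j F j (c j))); last first.
  move=> c _; rewrite /F big_split /=; congr (_ * _).
  rewrite mulrC expRM_natl -prodr_const [LHS]big_mkcond /=.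
  by apply: eq_bigr => j _; rewrite inE; case: (j \in T).
rewrite sum_vec_prod expRM_natr.
rewrite -prodr_const [leRHS]big_mkcond /=; apply: ler_prod => j _.
have b0 := bern_gt0 hq b.
have -> : F j true + F j false
    = if j \in T then bern q b * expR (- s) + (1 - bern q b) else 1.
  rewrite /F; case: ifP => _; case: (b); rewrite /bern /=; lra.
case: ifP => _; last by rewrite lexx ler01.
have b1 : bern q b <= 1 by have := bernD q b; have := bern_gt0 hq (~~ b); lra.
have := expR_gt0 (- s); have := expR_neg_le s0 => h1 h2; apply/andP; split; first by nra.
apply: le_trans (expR_ge1Dx _).
have : 0 <= s - s ^+ 2 by nra.
nra.
Qed.

(** The rows are independent, hence the N-th power; the factor 2 is for the two answers [b]. *)
Lemma unbalanced_rows_prob (T : {set 'I_N}) (p eps : R) : 0 < eps <= 1 ->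
  0 <= p -> p <= q -> p <= 1 - q ->
  Pr (fun A => forall i, exists b,
        (row_count A T b i)%:R < (1 - eps) * p * #|T|%:R)
  <= (2 * expR (- (eps ^+ 2 / 4 * p * #|T|%:R))) ^+ N.
Proof.
move=> /andP[e0 e1] p0 pq p1q.
(* The Chernoff exponent is p |T| (s^2 - eps s), minimal at s = eps / 2. *)
pose s := eps / 2; pose thr := (1 - eps) * p * #|T|%:R.
have s01 : 0 <= s <= 1 by apply/andP; rewrite /s; split; lra.
pose G b (c : {ffun 'I_N -> bool}) : R :=
  expR (s * thr) * expR (- s * #|[set j in T | c j == b]%SET|%:R).
have G0 b c : 0 <= G b c by rewrite mulr_ge0 ?expR_ge0.
apply: (@le_trans _ _ (\sum_A (\prod_i (G true (row_vec A i) + G false (row_vec A i)))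
    * mx_weight q A)).
  apply: (prob_le_expect hq) => A => [|bad].
    by apply: prodr_ge0 => i _; rewrite addr_ge0.
  apply: (big_ind (fun x : R => 1 <= x)) => // [x y|i _]; first exact: mulr_ege1.
  have [b lt_b] := bad i.
  have : 1 <= G b (row_vec A i).
    rewrite /G -expRD -[leLHS]expR0 ler_expR mulNr -mulrBr mulr_ge0 ?subr_ge0 //.
      by case/andP: s01.
    rewrite (_ : [set j in T | _]%SET = [set j in T | A i j == b]%SET).
      exact: ltW.
    by apply/setP => j; rewrite !inE ffunE.
  by case: b {lt_b} => h; have := G0 true (row_vec A i); have := G0 false (row_vec A i); lra.
rewrite (expect_rows q (fun _ c => G true c + G false c)).
under eq_bigr do under eq_bigr do rewrite mulrDl.
rewrite -[X in _ <= _ ^+ X]card_ord -prodr_const; apply: ler_prod => i _.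
rewrite big_split /=; have w0 := vec_weight_ge0 hq.
apply/andP; split.
  by rewrite addr_ge0 // sumr_ge0 // => c _; rewrite mulr_ge0.
suff h b : \sum_c G b c * vec_weight q c <= expR (- (eps ^+ 2 / 4 * p * #|T|%:R)).
  by have := h true; have := h false; lra.
rewrite /G; under eq_bigr do rewrite -mulrA.
rewrite -big_distrr /=.
have pb : p <= bern q b by case: b.
apply: (@le_trans _ _ (expR (s * thr) * expR (- (p * (s - s ^+ 2)) * #|T|%:R))).
  by rewrite ler_wpM2l ?expR_ge0 // vec_count_mgf.
rewrite -expRD ler_expR /thr /s le_eqVlt; apply/orP; left; apply/eqP.
by field.
Qed.

End Chernoff.

(** Every such set is the range of a partial function from ['I_r] to ['I_N]. *)
Lemma card_small_sets (N r : nat) :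
  (#|[set S : {set 'I_N} | (#|S| <= r)%N]%SET| <= N.+1 ^ r)%N.
Proof.
pose f (h : {ffun 'I_r -> option 'I_N}) : {set 'I_N} :=
  [set x | [exists k, h k == Some x]]%SET.
apply: (@leq_trans #|[set f h | h : {ffun 'I_r -> option 'I_N}]%SET|); last first.
  by rewrite (leq_trans (leq_imset_card _ _)) // card_ffun card_option !card_ord.
apply: subset_leq_card; apply/fintype.subsetP => S; rewrite inE => Sr.
pose h := [ffun k : 'I_r => nth None (map Some (enum S)) k].
apply/imsetP; exists h => //; apply/setP => x; rewrite inE.
apply/idP/existsP => [xS|[k]].
  have xr : (index x (enum S) < r)%N.
    by apply: leq_trans Sr; rewrite cardE index_mem mem_enum.
  exists (Ordinal xr); rewrite ffunE (nth_map x) ?nth_index ?mem_enum //.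
  by rewrite index_mem mem_enum.
rewrite ffunE; have [kS|kS] := ltnP k (size (enum S)).
  rewrite (nth_map x) // => /eqP[<-].
  by rewrite -mem_enum mem_nth.
by rewrite nth_default // size_map.
Qed.

Lemma prob_small_sets (R : realType) (N r : nat) (q B : R)
    (E : {set 'I_N} -> 'M[bool]_N -> Prop) : 0 < q < 1 -> 0 <= B ->
  (forall S : {set 'I_N}, (#|S| <= r)%N -> random_matrix_prob q (E S) <= B) ->
  random_matrix_prob q (fun A => exists2 S : {set 'I_N}, (#|S| <= r)%N & E S A)
  <= N.+1%:R ^+ r * B.
Proof.
move=> hq B0 hB; apply: (le_trans (prob_exists hq _ _)).
apply: (@le_trans _ _ (\sum_(S : {set 'I_N} | (#|S| <= r)%N) B)).
  exact: ler_sum.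
rewrite sumr_const -[X in X <= _]mulr_natl ler_wpM2r // -natrX ler_nat -cardsE.
exact: card_small_sets.
Qed.

(** * The greedy strategy and deterministic bounds *)

Lemma minimum_le (P : nat -> Prop) r : P r ->
  exists2 r', minimum P = Some r' & (r' <= r)%N /\ P r'.
Proof.
move=> Pr; rewrite /minimum; case: pselect => [h|]; last first.
  by case; exists r; apply/asboolP.
exists (ex_minn h) => //; case: ex_minnP => m /asboolP Pm min_m; split=> //.
by apply: min_m; apply/asboolP.
Qed.

Lemma minimum_Some (P : nat -> Prop) r : minimum P = Some r -> P r.
Proof.
rewrite /minimum; case: pselect => // h [<-].
by case: ex_minnP => m /asboolP.
Qed.

Lemma minimum_None (P : nat -> Prop) : (forall r, ~ P r) -> minimum P = None.
Proof.
by move=> nP; rewrite /minimum; case: pselect => // -[r Pr]; case: (nP r); apply/asboolP.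
Qed.

Arguments encode : simpl never.

Section Combinatorics.
Local Open Scope nat_scope.

Lemma nth_allpairs_row (S T U : Type) (f : S -> T -> U) s t u0 s0 t0 k v :
  k < size s -> v < size t ->
  nth u0 [seq f i j | i <- s, j <- t] (k * size t + v) = f (nth s0 s k) (nth t0 t v).
Proof.
move=> + vt; elim: s k => // a s IH [_|k ks]; rewrite allpairs_cons nth_cat size_map.
  by rewrite mul0n add0n vt (nth_map t0).
by rewrite mulSn -addnA ltnNge leq_addr /= addKn IH.
Qed.

(** * The program's quantities on an encoded input *)

Section Encoding.
Variables (n : nat) (A : 'M[bool]_n.+1) (R : {set 'I_n.+1}) (vstar : 'I_n.+1).
Local Notation x := (encode A R (restr_col A R vstar)).

Let size_cells : size [seq nat_of_bool (A i j) | i <- enum 'I_n.+1, j <- enum 'I_n.+1]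
  = n.+1 * n.+1.
Proof. by rewrite size_allpairs -cardT card_ord. Qed.

Lemma nth_encode_matrix (k v : 'I_n.+1) : nth 0 x (1 + k * n.+1 + v) = A k v.
Proof.
rewrite -addnA add1n /encode [nth _ _ _]/= nth_cat size_cells ifT; last first.
  by have := ltn_ord k; have := ltn_ord v; nia.
have := @nth_allpairs_row _ _ _ (fun i j => nat_of_bool (A i j)) (enum 'I_n.+1)
  (enum 'I_n.+1) 0 ord0 ord0 k v.
by rewrite -cardT card_ord !nth_ord_enum => ->.
Qed.

Lemma nth_encode_rows (k : 'I_n.+1) : nth 0 x (1 + n.+1 * n.+1 + k) = (k \in R).
Proof.
rewrite -addnA add1n /encode [nth _ _ _]/= nth_cat size_cells ltnNge leq_addr /= addKn.
rewrite nth_cat size_map -cardT card_ord ltn_ord (nth_map ord0).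
  by rewrite nth_ord_enum.
by rewrite -cardT card_ord.
Qed.

Lemma nth_encode_answers (k : 'I_n.+1) :
  nth 0 x (1 + n.+1 * n.+1 + n.+1 + k) = (k \in R) && A k vstar.
Proof.
rewrite -!addnA add1n /encode [nth _ _ _]/= nth_cat size_cells ltnNge leq_addr /= addKn.
rewrite nth_cat size_map -cardT card_ord ltnNge leq_addr /= addKn (nth_map ord0).
  by rewrite nth_ord_enum ffunE; case: (k \in R) => //=; case: (A k vstar).
by rewrite -cardT card_ord.
Qed.

Lemma alive_encode (v : 'I_n.+1) : alive x n.+1 v = (v \in candidates A R vstar).
Proof.
rewrite /alive /mismatches big_mkord.
rewrite (eq_bigr (fun k : 'I_n.+1 => nat_of_bool ((k \in R) && (A k v != A k vstar))));
  last first.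
  move=> k _; rewrite nth_encode_matrix nth_encode_rows nth_encode_answers.
  by case: (k \in R); case: (A k v); case: (A k vstar).
rewrite inE; have [e|ne] := eqVneq (restr_col A R v) (restr_col A R vstar).
  rewrite big1 // => k _; have /ffunP/(_ k) := e; rewrite !ffunE.
  by case: (k \in R) => //= -[->]; rewrite eqxx.
have /existsP[k nk] : [exists k, restr_col A R v k != restr_col A R vstar k].
  apply: contraNT ne; rewrite negb_exists => /forallP h.
  by apply/eqP/ffunP => k; apply/eqP/negPn/h.
rewrite (bigD1 k) //=; move: nk; rewrite !ffunE; case: (k \in R) => //= nk.
by rewrite (_ : A k v != A k vstar) ?add1n ?subSS ?sub0n //; apply: contra nk => /eqP ->.
Qed.

Lemma row_score_encode (i : 'I_n.+1) : row_score x n.+1 i =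
  minn (row_count A (candidates A R vstar) true i)
       (row_count A (candidates A R vstar) false i).
Proof.
have o : ones_upto x n.+1 n.+1 i = row_count A (candidates A R vstar) true i.
  rewrite /ones_upto big_mkord /row_count -sum1_card [RHS]big_mkcond.
  apply: eq_bigr => v _; rewrite inE alive_encode nth_encode_matrix.
  by case: (v \in _); case: (A i v).
have z : zeros_upto x n.+1 n.+1 i = row_count A (candidates A R vstar) false i.
  rewrite /zeros_upto big_mkord /row_count -sum1_card [RHS]big_mkcond.
  apply: eq_bigr => v _; rewrite inE alive_encode nth_encode_matrix.
  by case: (v \in _); case: (A i v).
by rewrite /row_score o z; lia.
Qed.

End Encoding.

Lemma best_upto_lt x N j : 0 < N -> j <= N -> (best_upto x N j).1 < N.
Proof.
by move=> N0; elim: j => //= j IH jN; case: ifP => _ //=; exact: IH (ltnW jN).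
Qed.

Lemma best_upto_max x N j i : i < j -> row_score x N i <= (best_upto x N j).2.
Proof.
elim: j => //= j IH; rewrite ltnS leq_eqVlt => /orP[/eqP <-|/IH le_i].
  by case: ltnP.
by case: ltnP => //= lt_j; exact: leq_trans (ltnW lt_j).
Qed.

Lemma best_upto_score x N j : (best_upto x N j).2 <= row_score x N (best_upto x N j).1.
Proof. by elim: j => //= j IH; case: ifP. Qed.

(** Defined as the value that the program computes, so polynomial time is immediate; [greedy_max]
    recovers the combinatorial meaning. *)
Definition greedy : strategy := fun n A R y =>
  inord (best_upto (encode A R y) n.+1 n.+1).1.

Lemma greedy_polynomial_time : polynomial_time greedy.
Proof.
exists (compile 0 greedy_code), 100 => n A R v /=.
rewrite /greedy inordK ?best_upto_lt //.
by apply: greedy_code_ok.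
Qed.

Lemma greedy_max n (A : 'M[bool]_n.+1) R v (i : 'I_n.+1) :
  let T := candidates A R v in let k := greedy A R (restr_col A R v) in
  minn (row_count A T true i) (row_count A T false i)
  <= minn (row_count A T true k) (row_count A T false k).
Proof.
rewrite /= -!row_score_encode.
apply: leq_trans (best_upto_max _ _ (ltn_ord i)) _.
by rewrite /greedy inordK ?best_upto_lt // best_upto_score.
Qed.

(** * Candidates under the greedy strategy *)

Section Candidates.
Variables (n : nat) (A : 'M[bool]_n.+1).

Lemma mem_candidates R u : u \in candidates A R u.
Proof. by rewrite inE. Qed.

Lemma candidatesP (R : {set 'I_n.+1}) u v :
  reflect (forall i, i \in R -> A i u = A i v) (u \in candidates A R v).
Proof.
rewrite inE; apply: (iffP eqP) => [/ffunP h i iR|h].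
  by have := h i; rewrite !ffunE iR => -[].
by apply/ffunP => i; rewrite !ffunE; case: ifP => // /h ->.
Qed.

Lemma candidatesU1 R i v : candidates A (R :|: [set i])%SET v
  = [set u in candidates A R v | A i u == A i v]%SET.
Proof.
apply/setP => u; rewrite [RHS]inE; apply/candidatesP/andP => [h|[/candidatesP h /eqP hi] k].
  split; first by apply/candidatesP => k kR; apply: h; rewrite !inE kR.
  by apply/eqP/h; rewrite !inE eqxx orbT.
by rewrite !inE => /orP[/h|/eqP ->].
Qed.

Lemma row_countD T i : row_count A T true i + row_count A T false i = #|T|.
Proof.
rewrite /row_count -(cardsID [set j | A i j]%SET T); congr (_ + _).
  by apply: eq_card => j; rewrite !inE; case: (A i j).
by apply: eq_card => j; rewrite !inE; case: (A i j); rewrite ?andbF ?andbT.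
Qed.

(** Whatever the answer, the queried row removes at least the smaller of its two classes, and by
    [greedy_max] this is no smaller than for row i. *)
Lemma greedy_step v j i :
  let T := candidates A (queried greedy A v j) v in
  #|candidates A (queried greedy A v j.+1) v|
  + minn (row_count A T true i) (row_count A T false i) <= #|T|.
Proof.
cbv zeta; set T := candidates A (queried greedy A v j) v.
set k := greedy A (queried greedy A v j) (restr_col A (queried greedy A v j) v).
rewrite -[queried greedy A v j.+1]/(queried greedy A v j :|: [set k])%SET candidatesU1.
have := greedy_max A (queried greedy A v j) v i; rewrite -/k -/T /=.
have := row_countD T k; rewrite -/(row_count A T (A k v) k).
move: (row_count A T true i) (row_count A T false i) #|T| => c d t.
by case: (A k v); move: (row_count A T true k) (row_count A T false k) => a b; lia.
Qed.

(** While two candidates remain, some row separates them, so its smaller class is nonempty and the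
    greedy query removes a candidate. The case m = 0 is void since v is its own candidate. *)
Lemma greedy_shrinks v j m : injective (restr_col A [set: 'I_n.+1]) ->
  #|candidates A (queried greedy A v j) v| <= m ->
  #|candidates A (queried greedy A v (j + m)) v| = 1.
Proof.
move=> injA; elim: m j => [|m IH] j tm.
  have := mem_candidates (queried greedy A v j) v; move: tm.
  by rewrite leqn0 cards_eq0 => /eqP ->; rewrite inE.
rewrite addnS -addSn; set T := candidates A (queried greedy A v j) v in tm.
have [T1|] := leqP #|T| 1.
  have mono l : #|candidates A (queried greedy A v (j + l)) v| <= 1.
    elim: l => [|l le1]; first by rewrite addn0.
    by rewrite addnS; have := greedy_step v (j + l) ord0; lia.
  apply/eqP; rewrite eqn_leq addSn -addnS mono /= card_gt0.
  by apply/set0Pn; exists v; exact: mem_candidates.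
rewrite (cardsD1 v) mem_candidates ltnS card_gt0 => /set0Pn[u].
rewrite 2!inE => /andP[uv uT].
have /existsP[i nui] : [exists i, A i u != A i v].
  apply: contraNT uv; rewrite negb_exists => /forallP h; apply/eqP/injA/ffunP => i.
  by rewrite !ffunE inE (eqP (negPn (h i))).
apply: IH; have := greedy_step v j i; rewrite -/T /=.
have row_pos b w : w \in T -> A i w = b -> 0 < row_count A T b i.
  by move=> wT wb; rewrite card_gt0; apply/set0Pn; exists w; rewrite inE wT wb eqxx.
have pos b : 0 < row_count A T b i.
  have [ub|] := eqVneq (A i u) b; first exact: row_pos uT ub.
  move=> nub; apply: (row_pos _ v); first exact: mem_candidates.
  by move: nui nub; case: (A i u) (A i v) b => [] [] [].
have := pos true; have := pos false; move: tm.
move: (row_count A T true i) (row_count A T false i) #|T| #|_| => c d t u'; lia.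
Qed.

Lemma candidates_mono v j :
  #|candidates A (queried greedy A v j.+1) v| <= #|candidates A (queried greedy A v j) v|.
Proof. by have := greedy_step v j ord0; lia. Qed.

End Candidates.

(** The adversary always answers [b]. All columns equal to [b] on the resulting [path] of queries
    induce that same path, so two of them remain candidates together. *)
Lemma SQC_lower n (A : 'M[bool]_n.+1) b r0 r :
  (forall S : {set 'I_n.+1}, #|S| <= r0 -> 1 < #|constant_cols b S A|) ->
  SQC A = Some r -> r0 < r.
Proof.
move=> many; rewrite /SQC /minimum; case: pselect => // h [<-].
case: ex_minnP => m /asboolP[g gm] _; rewrite ltnNge; apply/negP => mr.
pose y (S : {set 'I_n.+1}) : {ffun 'I_n.+1 -> option bool} :=
  [ffun i => if i \in S then Some b else None].
pose path := fix path j : {set 'I_n.+1} :=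
  if j is k.+1 then (path k :|: [set g n A (path k) (y (path k))])%SET else finset.set0.
have card_path j : #|path j| <= j.
  elim: j => [|j IH]; first by rewrite cards0.
  by rewrite /= (leq_trans (leq_card_setU _ _)) // cards1 addn1.
have sub_path i j : i <= j -> path i \subset path j.
  move=> /subnK <-; elim: (j - i) => // k; rewrite addSn /= => h1.
  by apply: (fintype.subset_trans h1); exact: finset.subsetUl.
have queried_path u : u \in constant_cols b (path m) A ->
    forall j, j <= m -> queried g A u j = path j.
  rewrite inE => /forall_inP ub; elim=> //= j IH jm.
  rewrite IH ?(ltnW jm) //; congr (_ :|: [set g n A _ _])%SET.
  apply/ffunP => i; rewrite !ffunE; case: ifP => // ij; congr Some.
  by apply/eqP/ub; apply: (fintype.subsetP (sub_path _ _ (ltnW jm))).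
have /card_gt1P[u [v [uc vc uv]]] := many _ (leq_trans (card_path m) mr).
have := gm u; rewrite (queried_path u uc _ (leqnn _)) => /eqP/cards1P[w cw].
have cwE z : z \in constant_cols b (path m) A -> z = w.
  move=> zc; apply/set1P; rewrite -cw; apply/candidatesP => i im.
  move: zc uc; rewrite !inE => /forall_inP/(_ _ im)/eqP -> /forall_inP/(_ _ im)/eqP.
  by [].
by move: uv; rewrite (cwE _ uc) (cwE _ vc) eqxx.
Qed.

Lemma QC_lower N (A : 'M[bool]_N) r0 r :
  (forall S : {set 'I_N}, #|S| <= r0 -> ~ injective (restr_col A S)) ->
  QC A = Some r -> r0 < r.
Proof.
move=> ninj; rewrite /QC /minimum; case: pselect => // h [<-].
case: ex_minnP => m /asboolP[S [<- injS]] _; rewrite ltnNge; apply/negP => /ninj.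
exact.
Qed.

Section EqualColumns.
Variables (n : nat) (A : 'M[bool]_n.+1) (b : bool).
Hypothesis many : 1 < #|constant_cols b [set: 'I_n.+1]%SET A|.

Let equal_columns : exists u v : 'I_n.+1, u != v /\ forall i, A i u = A i v.
Proof.
have /card_gt1P[u [v [uc vc uv]]] := many; exists u, v; split=> // i.
move: uc vc; rewrite !inE => /forall_inP/(_ i (finset.in_setT i))/eqP ->.
by move=> /forall_inP/(_ i (finset.in_setT i))/eqP ->.
Qed.

Lemma SQC_None : SQC A = None.
Proof.
apply: minimum_None => r [g gr]; have [u [v [uv Auv]]] := equal_columns.
have /eqP/cards1P[w cw] := gr u; move: uv; have h z : (forall i, A i z = A i u) -> z = w.
  by move=> zu; apply/set1P; rewrite -cw; apply/candidatesP => i _.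
by rewrite (h u) // (h v) ?eqxx // => i; rewrite Auv.
Qed.

Lemma QC_None : QC A = None.
Proof.
apply: minimum_None => r [S [_ injS]]; have [u [v [uv Auv]]] := equal_columns.
move/eqP: uv; apply; apply: injS; apply/ffunP => i; rewrite !ffunE.
by case: ifP => // _; rewrite Auv.
Qed.

End EqualColumns.

End Combinatorics.

(* Above K candidates, a balanced row keeps a fraction rho of them; below K, a
   row separating two candidates removes at least one. *)
Lemma greedy_identifies (R : realType) n (A : 'M[bool]_n.+1) (K rho : R) (J M : nat) :
  injective (restr_col A [set: 'I_n.+1]%SET) -> 0 <= rho <= 1 ->
  (forall T : {set 'I_n.+1}, K <= #|T|%:R ->
     exists i, forall b, (1 - rho) * #|T|%:R <= (row_count A T b i)%:R) ->
  n.+1%:R * rho ^+ J <= K -> K < M.+1%:R ->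
  identifies greedy A (J + M).
Proof.
move=> injA /andP[rho0 rho1] bal NJ KM v.
pose t j := #|candidates A (queried greedy A v j) v|.
(* The maximum absorbs both regimes: below K monotonicity suffices, above K the count shrinks by
   [rho]. *)
have tJ j : (t j)%:R <= Num.max K (n.+1%:R * rho ^+ j).
  elim: j => [|j IH].
    rewrite expr0 mulr1 le_max; apply/orP; right.
    by rewrite ler_nat /t (leq_trans (max_card _)) // card_ord.
  have [Kt|tK] := leP K (t j)%:R; last first.
    rewrite le_max; apply/orP; left; apply: le_trans (ltW tK).
    by rewrite ler_nat; exact: candidates_mono.
  have [i bali] := bal _ Kt; have := greedy_step A v j i; rewrite -/(t j) -/(t j.+1) /=.
  pose T := candidates A (queried greedy A v j) v.
  have h : (1 - rho) * (t j)%:R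
      <= (minn (row_count A T true i) (row_count A T false i))%:R.
    by rewrite /minn; case: ifP => _; exact: bali.
  move: h; set mn := minn _ _ => h; rewrite -(ler_nat R) natrD => h2.
  have h3 : (t j.+1)%:R <= rho * (t j)%:R by lra.
  apply: (le_trans h3); move: IH; rewrite !le_max => /orP[tK|tN]; apply/orP.
    by left; apply: le_trans tK; rewrite ler_piMl.
  by right; rewrite exprS mulrCA ler_wpM2l.
apply: greedy_shrinks => //; rewrite -/(t J) -ltnS -(ltr_nat R).
by apply: le_lt_trans KM; apply: (le_trans (tJ J)); rewrite ge_max lexx.
Qed.

(** * Asymptotics *)

Section Asymptotic.
Variable R : realType.
Implicit Types (q : nat -> R) (n : nat).
Local Notation logn n := (ln n.+1%:R : R).

Lemma expR_logn n : expR (logn n) = n.+1%:R.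
Proof. by rewrite lnK // posrE. Qed.

Lemma near_succ (P : nat -> Prop) : (\forall N \near \oo%classic, P N) ->
  \forall n \near \oo%classic, P n.+1.
Proof. by case=> M _ h; exists M => // n /= Mn; apply: h => /=; exact: leqW. Qed.

Lemma near_logn_ge (M : R) : \forall n \near \oo%classic, M <= logn n.
Proof.
exists (Num.truncn (expR M)) => // n /= Mn.
rewrite -[leLHS]expRK ler_ln ?posrE ?expR_gt0 //.
have /andP[_ /ltW/le_trans] := truncn_itv (expR_ge0 M); apply.
by rewrite ler_nat.
Qed.

Lemma near_sqr_logn_le (c M : R) : 0 < c ->
  \forall n \near \oo%classic, M * logn n ^+ 2 <= expR (c * logn n).
Proof.
move=> c0; have [Mlt0|M0] := ltP M 0.
  near=> n; apply: le_trans (expR_ge0 _).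
  by rewrite mulr_le0_ge0 ?sqr_ge0 // ltW.
(* The cubic term (c ln N)^3 / 6 of the exponential series exceeds M (ln N)^2 from here on. *)
have := near_logn_ge (6 * M / c ^+ 3); have := near_logn_ge 0.
apply: filterS2 => n l0 lM.
have cl : 0 <= c * logn n by rewrite mulr_ge0 // ltW.
apply: le_trans (le_trans _ (expR_ge1Dxn 2 cl)) => //.
move: lM; rewrite ler_pdivrMr ?exprn_gt0 // => lM.
rewrite (_ : 3`!%:R = 6 :> R) // exprMn.
have := ler_wpM2r (sqr_ge0 (logn n)) lM; move: (logn n) => l.
have -> : l * c ^+ 3 * l ^+ 2 = c ^+ 3 * l ^+ 3 by ring.
lra.
Unshelve. all: by end_near. Qed.

Lemma near_expR_logn_le (c d : R) : 0 < c -> 0 < d ->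
  \forall n \near \oo%classic, expR (- (c * logn n)) <= d.
Proof.
move=> c0 d0; have := near_logn_ge (- ln d / c); apply: filterS => n.
rewrite ler_pdivrMr // => h.
by rewrite -[leRHS]lnK ?posrE // ler_expR; lra.
Qed.

(** * Asymptotically almost sure events *)

Section AAS.
Variable q : nat -> R.
Hypothesis hq : forall N, 0 < q N < 1.
Implicit Types E F : forall n, 'M[bool]_n.+1 -> Prop.

Lemma aas_intro E : (forall d : R, 0 < d -> \forall n \near \oo%classic,
    random_matrix_prob (q n.+1) (fun A => ~ E n A) <= d) -> aas q E.
Proof.
move=> h; apply/cvgrPdist_le => d d0; have := h d d0; apply: filterS => n hn.
rewrite ger0_norm ?subr_ge0 ?(prob_le1 (hq _)) //.
by move: hn; rewrite prob_not.
Qed.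

Lemma aas_elim E : aas q E -> forall d : R, 0 < d -> \forall n \near \oo%classic,
  1 - d <= random_matrix_prob (q n.+1) (@E n).
Proof.
move=> /cvgrPdist_le h d d0; have := h d d0; apply: filterS => n.
by rewrite ger0_norm ?subr_ge0 ?(prob_le1 (hq _)) // => ?; lra.
Qed.

Lemma prob_and_ge n E F d e :
  1 - d <= random_matrix_prob (q n.+1) (@E n) ->
  1 - e <= random_matrix_prob (q n.+1) (@F n) ->
  1 - (d + e) <= random_matrix_prob (q n.+1) (fun A => E n A /\ F n A).
Proof.
move=> hE hF.
have := prob_not (q n.+1) (fun A => E n A /\ F n A).
have := prob_or (hq n.+1) (fun A => ~ E n A) (fun A => ~ F n A).
have : random_matrix_prob (q n.+1) (fun A => ~ (E n A /\ F n A)) <=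
  random_matrix_prob (q n.+1) (fun A => ~ E n A \/ ~ F n A).
  by apply: (prob_mono (hq n.+1)) => A /not_andP.
by rewrite !prob_not; lra.
Qed.

Lemma aas_and E F : aas q E -> aas q F -> aas q (fun n A => E n A /\ F n A).
Proof.
move=> /aas_elim hE /aas_elim hF; apply/cvgrPdist_le => d d0.
have d2 : 0 < d / 2 by lra.
have := hF _ d2; have := hE _ d2; apply: filterS2 => n hnE hnF.
rewrite ger0_norm ?subr_ge0 ?(prob_le1 (hq _)) //.
by have := prob_and_ge hnE hnF; lra.
Qed.

Lemma aas_mono E F : (\forall n \near \oo%classic, forall A, E n A -> F n A) ->
  aas q E -> aas q F.
Proof.
move=> EF /aas_elim hE; apply/cvgrPdist_le => d d0.
have := hE _ d0; have := EF; apply: filterS2 => n EFn hn.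
rewrite ger0_norm ?subr_ge0 ?(prob_le1 (hq _)) //.
by have := prob_mono (hq n.+1) EFn; lra.
Qed.

(* Take for e n.+1 the least 1 / (k + 8) with k <= n for which the event has
   probability at least 1 - 1 / (k + 8). *)
Lemma aas_diagonal (E : R -> forall n, 'M[bool]_n.+1 -> Prop) :
  (forall eps, 0 < eps <= 8^-1 -> aas q (E eps)) ->
  exists e : nat -> R, little_o1 e /\ aas q (fun n => E (e n.+1) n).
Proof.
(* The shift by 8 keeps every [u k] in the range (0, 1/8] where the hypothesis applies. *)
move=> hE; pose u k : R := (k + 8)%:R^-1.
have u0 k : 0 < u k by rewrite invr_gt0 ltr0n addnS.
have u_mono j k : (j <= k)%N -> u k <= u j.
  move=> jk; rewrite lef_pV2 ?posrE ?ltr0n ?addnS //.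
  by rewrite ler_nat !ltnS leq_add2r.
have u_small d : 0 < d -> exists k, u k <= d.
  move=> d0; exists (Num.truncn d^-1).
  have d1 : 0 <= d^-1 by rewrite invr_ge0 ltW.
  have /andP[_ h] := truncn_itv d1.
  rewrite -[leRHS]invrK lef_pV2 ?posrE ?ltr0n ?invr_gt0 ?addnS //.
  by apply: (le_trans (ltW h)); rewrite ler_nat; lia.
pose good n (k : 'I_n.+1) := 1 - u k <= random_matrix_prob (q n.+1) (E (u k) n).
(* This is 0 when no index is good; [key] shows that for large n a good index exists and the maximum
   is attained. *)
pose kn n : nat := (\max_(k in @good n) k)%N.
have key d : 0 < d -> \forall n \near \oo%classic,
    u (kn n) <= d /\ 1 - u (kn n) <= random_matrix_prob (q n.+1) (E (u (kn n)) n).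
  move=> d0; have [K uK] := u_small d d0.
  have uK8 : 0 < u K <= 8^-1.
    by rewrite u0 /= (_ : 8^-1 = u 0%N) ?u_mono // /u add0n.
  have := aas_elim (hE _ uK8) (u0 K); have := nbhs_infty_ge K.
  apply: filterS2 => n Kn gK.
  have Kn1 : (K < n.+1)%N by [].
  have gK' : Ordinal Kn1 \in @good n by [].
  split.
    apply: le_trans uK; apply: u_mono.
    exact: (@leq_bigmax_cond _ (fun k => k \in @good n) (fun k => nat_of_ord k) _ gK').
  have pos : (0 < #|@good n|)%N by apply/card_gt0P; exists (Ordinal Kn1).
  by rewrite /kn; have [k gk ->] := eq_bigmax_cond (fun k : 'I_n.+1 => nat_of_ord k) pos.
exists (fun N => u (kn N.-1)); split.
  apply/cvgrPdist_le => d d0; have [M _ h] := key d d0.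
  exists M.+1 => // N /= MN; rewrite sub0r normrN ger0_norm ?(ltW (u0 _)) //.
  by have [] := h N.-1; first by rewrite /=; lia.
apply/cvgrPdist_le => d d0; have := key d d0; apply: filterS => n [ud hn].
rewrite ger0_norm ?subr_ge0 ?(prob_le1 (hq _)) //.
by move: hn => /=; lra.
Qed.

End AAS.
End Asymptotic.

(** * Numerical estimates for the rates *)

Section Estimates.
Variable R : realType.
Local Notation logn n := (ln n.+1%:R : R).

Lemma ln_inv_bounds (g : R) : 2^-1 <= g < 1 -> let L := ln (1 / g) in
  [/\ 0 < L, L <= 1, 1 - g <= L, L <= 2 * (1 - g) & expR (- L) = g].
Proof.
move=> /andP[g2 g1] /=; rewrite div1r lnV ?posrE; last by lra.
have g0 : 0 < g by lra.
have h1 : ln g <= g - 1.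
  by have := @le_ln1Dx R (g - 1); rewrite addrCA subrr addr0; apply; lra.
have h2 : - ln g <= g^-1 - 1.
  rewrite -lnV ?posrE //.
  have := @le_ln1Dx R (g^-1 - 1); rewrite addrCA subrr addr0; apply.
  by have : 0 < g^-1; [rewrite invr_gt0|lra].
have h3 : g^-1 - 1 <= 2 * (1 - g).
  have -> : g^-1 - 1 = (1 - g) * g^-1 by field; lra.
  rewrite mulrC ler_wpM2r; [by []|lra|].
  by rewrite invf_ple ?posrE.
split; [lra|lra|lra|lra|]; by rewrite opprK lnK ?posrE.
Qed.

Lemma n2_le_expR (n : nat) : 1 <= logn n -> n.+2%:R <= expR (2 * logn n) :> R.
Proof.
move=> l1; have n1 : (0 < n)%N.
  by case: n l1 => //; rewrite ln1; lra.
rewrite -[2]/(2%:R) expRM_natl expR_logn -natrX ler_nat -mulnn; nia.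
Qed.

(** With l = ln N, the choice of r gives N g^r >= N^eps / L >= 40 l^2 / L, one eighth of which beats
    the cost 2 l r <= 2 l^2 / L of the union bound and the terms 1 + 2 l. *)
Lemma lower_bound_estimate (n : nat) (g eps : R) : 2^-1 <= g < 1 -> 0 < eps <= 1 ->
  1 <= logn n -> 40 * logn n ^+ 2 <= expR (eps * logn n) ->
  let L := ln (1 / g) in
  let r := Num.truncn ((1 + ln L / logn n - eps) * (logn n / L)) in
  1 <= n.+1%:R * g ^+ r /\
  expR 1 * n.+1%:R * expR (- (n.+1%:R * g ^+ r / 8)) * n.+2%:R ^+ r
  <= expR (- logn n).
Proof.
move=> hg /andP[e0 e1] l1 lW L r.
have [L0 L1 _ _ gL] : [/\ 0 < L, L <= 1, 1 - g <= L, L <= 2 * (1 - g) & expR (- L) = g].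
  exact: ln_inv_bounds.
have n2 := n2_le_expR l1; have l0 : 0 < logn n by lra.
clearbody L; rewrite -(expR_logn R n) ?expRK; move: (logn n) @r l1 l0 lW n2 => l r l1 l0 lW n2.
have lnL : ln L <= 0 by exact: ln_le0.
pose W := expR (eps * l).
have W0 : 0 < W by exact: expR_gt0.
have {}lW : 40 * l ^+ 2 <= W by [].
have -> : g ^+ r = expR (- (L * r%:R)) by rewrite -gL -expRM_natr mulNr.
rewrite -expRD.
have rn : n.+2%:R ^+ r <= expR (2 * l * r%:R) :> R.
  by rewrite expRM_natr; apply: lerXn2r => //; rewrite nnegrE ?expR_ge0.
set X := (1 + ln L / l - eps) * (l / L) in r rn *.
have XE : X * L = l + ln L - eps * l.
  have -> : X * L = (1 + ln L / l - eps) * l by rewrite /X -mulrA mulfVK ?lt0r_neq0.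
  by rewrite mulrBl mulrDl mul1r mulfVK ?lt0r_neq0.
have rX : 0 <= X -> r%:R <= X by move=> X0; have /andP[] := truncn_itv X0.
have r0 : X < 0 -> r = 0%N.
  by move=> X0; apply/truncn0Pn; rewrite -ltNge (lt_trans X0 ltr01).
move: r rX r0 rn => r rX r0 rn; clearbody X.
suff [m1 main] : 1 <= expR (l - L * r%:R) /\
    1 + l + 2 * l * r%:R - expR (l - L * r%:R) / 8 <= - l.
  split=> //; apply: (@le_trans _ _ (expR 1 * expR l * expR (- (expR (l - L * r%:R) / 8))
      * expR (2 * l * r%:R))).
    by rewrite ler_wpM2l // !mulr_ge0 ?expR_ge0.
  by rewrite -!expRD ler_expR; lra.
have ll : l <= l ^+ 2 by rewrite expr2 ler_peMr; lra.
have el : 0 <= eps * l by rewrite mulr_ge0; lra.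
have W1 : 1 <= W by rewrite -expR0 ler_expR.
have [X0|X0] := leP 0 X.
  have {}rX := rX X0.
  have Lr : L * r%:R <= l + ln L - eps * l.
    by rewrite -XE mulrC ler_wpM2r // ltW.
  have WL : W / L <= expR (l - L * r%:R).
    rewrite -[X in _ / X]lnK ?posrE // -expRN -expRD ler_expR; lra.
  have W_le : W <= W / L by rewrite ler_pdivlMr // ler_piMr // ltW.
  have rl : l * r%:R <= l ^+ 2 / L.
    by rewrite ler_pdivlMr // expr2 -mulrA ler_wpM2l; [|lra|rewrite mulrC; lra].
  have lL : l ^+ 2 <= l ^+ 2 / L by rewrite ler_pdivlMr // ler_piMr ?sqr_ge0.
  have WlL : 40 * (l ^+ 2 / L) <= W / L by rewrite mulrA ler_pM2r ?invr_gt0.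
  split; lra.
(* A negative target truncates to r = 0, and N g^0 = N is at least N^eps. *)
rewrite (r0 X0).
rewrite mulr0 subr0 mulr0 addr0.
have Wl : W <= expR l by rewrite ler_expR ler_piMl; lra.
split; lra.
Qed.

Lemma one_minus_exp_le (x : R) (n : nat) : 0 <= x <= 1 ->
  (1 - x) ^+ n <= expR (- (n%:R * x)).
Proof.
move=> /andP[x0 x1]; rewrite -mulrN expRM_natl; apply: lerXn2r.
- by rewrite nnegrE; lra.
- by rewrite nnegrE expR_ge0.
- exact: expR_ge1Dx.
Qed.

Lemma sum_exp_card (T : finType) (x : R) :
  \sum_(S : {set T}) x ^+ #|S| = (1 + x) ^+ #|T|.
Proof.
rewrite -[X in _ ^+ X]/(#|[pred _ : T | true]|) -prodr_const addrC.
rewrite (bigA_distr _ _ (fun=> x) (fun=> 1)); apply: eq_bigr => S _.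
by rewrite -prodr_const big_mkcond.
Qed.

Lemma next_nat (y : R) : 0 <= y -> exists r : nat, y < r%:R <= y + 1.
Proof.
move=> y0; exists (Num.truncn y).+1; have /andP[ry ->] := truncn_itv y0.
by rewrite -natr1 lerD2r.
Qed.

(** J balanced queries bring N candidates down to the threshold K = eps ln N / p, and M is the
    integer part of K. *)
Lemma greedy_steps (n : nat) (g eps : R) : 2^-1 <= g < 1 -> 0 < eps <= 8^-1 ->
  1 <= eps * logn n ->
  let p := 1 - g in let L := ln (1 / g) in
  exists J M : nat, [/\ n.+1%:R * (1 - (1 - eps) * p) ^+ J <= eps * logn n / p,
    eps * logn n / p < M.+1%:R
  & (J + M)%:R <= (1 + 7 * eps) * (logn n / L)].
Proof.
move=> hg /andP[e0 e8] el p L.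
have [L0 L1 pL Lp gL] : [/\ 0 < L, L <= 1, p <= L, L <= 2 * p & expR (- L) = g].
  exact: ln_inv_bounds.
case/andP: hg => g2 g1.
have p0 : 0 < p by rewrite /p; lra.
have p2 : p <= 2^-1 by rewrite /p; lra.
rewrite -(expR_logn R n) !expRK; move: (logn n) el => l el.
have l0 : 0 < l by rewrite -(pmulr_rgt0 _ e0); lra.
pose K := eps * l / p; pose Y := l / ((1 - 2 * eps) * L).
have K0 : 0 <= K by rewrite divr_ge0 //; lra.
have Y0 : 0 <= Y by rewrite divr_ge0 ?mulr_ge0; lra.
have /andP[MK KM] := truncn_itv K0; have /andP[JY YJ] := truncn_itv Y0.
exists (Num.truncn Y).+1, (Num.truncn K); split=> //.
  (* The left side is g + eps p <= g (1 + 2 eps p), as g >= 1/2, and g = e^(-L), p <= L. *)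
  have rho : 1 - (1 - eps) * p <= expR (- ((1 - 2 * eps) * L)).
    have -> : - ((1 - 2 * eps) * L) = - L + 2 * eps * L by ring.
    rewrite expRD gL; have := expR_ge1Dx (2 * eps * L) => h.
    have : 1 + 2 * eps * p <= expR (2 * eps * L).
      by apply: le_trans h; rewrite lerD2l ler_wpM2l //; lra.
    have -> : g = 1 - p by rewrite /p; ring.
    move=> hE; have p1 : 0 <= 1 - p by lra.
    have := ler_wpM2l p1 hE.
    have : 0 <= eps * p * (1 - 2 * p) by rewrite !mulr_ge0; lra.
    lra.
  apply: (@le_trans _ _ 1); last by rewrite ler_pdivlMr // mul1r; lra.
  apply: (@le_trans _ _ (expR l * expR (- l))); last by rewrite -expRD subrr expR0.
  rewrite ler_wpM2l ?expR_ge0 //.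
  apply: (@le_trans _ _ (expR (- ((1 - 2 * eps) * L)) ^+ (Num.truncn Y).+1)).
    apply: lerXn2r => //; rewrite nnegrE ?expR_ge0 //.
    by have : 0 <= eps * p; [rewrite mulr_ge0; lra|lra].
  rewrite -expRM_natr ler_expR mulNr lerN2.
  move: YJ; rewrite /Y ltr_pdivrMr; last by rewrite mulr_gt0; lra.
  by rewrite mulrC => /ltW.
(* The losses are 4 eps from [Y], 2 eps from [K] and eps from rounding, 7 eps in all. *)
rewrite natrD -natr1.
have lL : 0 <= l / L by rewrite divr_ge0 ?ltW.
have hY : Y <= (1 + 4 * eps) * (l / L).
  have -> : Y = (l / L) / (1 - 2 * eps) by rewrite /Y; field; lra.
  rewrite ler_pdivrMr; last by lra.
  have c1 : 1 <= (1 + 4 * eps) * (1 - 2 * eps).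
    by have : 0 <= eps * (8^-1 - eps); [rewrite mulr_ge0; lra|lra].
  by have := ler_wpM2l lL c1; lra.
have hK : K <= 2 * eps * (l / L).
  have -> : K = eps * l * p^-1 by [].
  have -> : 2 * eps * (l / L) = eps * l * (2 * L^-1) by ring.
  rewrite ler_wpM2l; [by []|lra|].
  by rewrite ler_pdivlMr // mulrC ler_pdivrMr.
have h1 : 1 <= eps * (l / L) by rewrite mulrA ler_pdivlMr // mul1r; lra.
lra.
Qed.

End Estimates.

Lemma near_and (P Q : nat -> Prop) : (\forall n \near \oo%classic, P n) ->
  (\forall n \near \oo%classic, Q n) -> \forall n \near \oo%classic, P n /\ Q n.
Proof. exact: filterS2. Qed.

(** * Almost sure bounds on the query complexities *)

Section Main.
Variables (R : realType) (q : nat -> R).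
Hypothesis hq : forall N, 0 < q N < 1.
Local Notation gs := (gamma_sqc q).
Local Notation gq := (gamma_qc q).
Local Notation logn n := (ln n.+1%:R : R).

Definition majority N : bool := 1 - q N <= q N.

Lemma gamma_sqcE N : gs N = bern (q N) (majority N).
Proof.
rewrite /gamma_sqc /majority /bern; case: ifP => [/max_idPl //|/negbT].
by rewrite -ltNge => /ltW/max_idPr.
Qed.

Lemma gamma_sqc_bounds N :
  [/\ 2^-1 <= gs N < 1, 1 - gs N <= q N & 1 - gs N <= 1 - q N].
Proof.
rewrite gamma_sqcE /bern /majority; have /andP[q0 q1] := hq N.
by case: (leP (1 - q N) (q N)) => h; split; try (apply/andP; split); lra.
Qed.

Lemma gamma_qc_sqr N : gq N ^+ 2 = q N ^+ 2 + (1 - q N) ^+ 2.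
Proof. by rewrite sqr_sqrtr // addr_ge0 // sqr_ge0. Qed.

(** The comparison is min(q, 1 - q) <= 2 q (1 - q) = 1 - gamma_qc^2 <= 2 (1 - gamma_qc). *)
Lemma gamma_qc_bounds N : 2^-1 <= gq N < 1 /\ 1 - gs N <= 2 * (1 - gq N).
Proof.
have /andP[q0 q1] := hq N; have [/andP[_ p0] pq p1q] := gamma_sqc_bounds N.
have g0 : 0 <= gq N by exact: sqrtr_ge0.
have := gamma_qc_sqr N; move: (gq N) g0 => g g0 g2.
have pp : 0 < q N * (1 - q N) by rewrite mulr_gt0; lra.
have h2 : g ^+ 2 = 1 - 2 * (q N * (1 - q N)) by rewrite g2; ring.
have g1 : g < 1 by rewrite -(@ltr_pXn2r _ 2) ?nnegrE // expr1n h2; lra.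
have gg : g ^+ 2 <= g by rewrite expr2 ler_piMr // ltW.
have p2 : (1 - gs N) <= 2 * (q N * (1 - q N)).
  have [h|h] := leP (q N) 2^-1.
    apply: (le_trans pq); have := ler_wpM2l (ltW q0) (_ : 2^-1 <= 1 - q N); lra.
  apply: (le_trans p1q); have := ler_wpM2r (_ : 0 <= 1 - q N) (ltW h); lra.
have sq2 : 2^-1 <= g ^+ 2.
  by rewrite g2; have := sqr_ge0 (q N - 2^-1); rewrite !expr2; lra.
split; first by apply/andP; split; lra.
have : 1 - g ^+ 2 <= 2 * (1 - g) by have := sqr_ge0 (g - 1); rewrite !expr2; lra.
lra.
Qed.

Lemma near_ge_logN (h : nat -> R) (C : R) : (forall N, 0 < h N) -> 0 < C ->
  much_less (@logN_over_N R) h ->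
  \forall n \near \oo%classic, C * logn n <= h n.+1 * n.+1%:R.
Proof.
move=> h0 C0 /cvgrPdist_le/(_ C^-1); rewrite invr_gt0 => /(_ C0)/near_succ.
apply: filterS => n; rewrite sub0r normrN /logN_over_N => /(le_trans (ler_norm _)).
rewrite ler_pdivrMr ?h0 // ler_pdivrMr // => le_l.
by rewrite -ler_pdivlMl // mulrA.
Qed.

Lemma near_le_logN (h : nat -> R) (c : R) : 0 < c ->
  much_less h (@logN_over_N R) ->
  \forall n \near \oo%classic, h n.+1 * n.+1%:R <= c * logn n.
Proof.
move=> c0 /cvgrPdist_le/(_ c c0)/near_succ h1; have := near_logn_ge (1 : R).
apply: filterS2 h1 => n; rewrite sub0r normrN /logN_over_N => le_c l1.
have := le_trans (ler_norm _) le_c; rewrite ler_pdivrMr ?divr_gt0 //; last lra.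
by rewrite mulrA ler_pdivlMr.
Qed.

Lemma few_majority_cols_prob (n r : nat) (S : {set 'I_n.+1}) : (0 < n)%N ->
  (#|S| <= r)%N ->
  random_matrix_prob (q n.+1)
    (fun A => (#|constant_cols (majority n.+1) S A| <= 1)%N)
  <= n.+1%:R * expR (- (n.+1%:R * gs n.+1 ^+ r / 2)).
Proof.
move=> n0 Sr; apply: (le_trans (few_constant_cols_prob (hq n.+1) _ _ _)) => //.
rewrite -gamma_sqcE ler_wpM2l //; have [/andP[g2 g1] _ _] := gamma_sqc_bounds n.+1.
have g0 : 0 <= gs n.+1 by lra.
apply: (le_trans (one_minus_exp_le _ _)).
  by rewrite exprn_ge0 //= exprn_ile1 // ltW.
(* The exponent N - 1 is at least N / 2, which accounts for the division by 2. *)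
rewrite ler_expR lerN2 mulrAC.
apply: (@le_trans _ _ (n.+1%:R / 2 * gs n.+1 ^+ #|S|)).
  by rewrite ler_wpM2l ?divr_ge0 // ler_wiXn2l // ltW.
rewrite ler_wpM2r ?exprn_ge0 // ler_pdivrMr // -[n.+1%:R]natr1.
have : 1 <= n%:R :> R by rewrite ler1n.
lra.
Qed.

Lemma near_lower_bound (eps : R) : 0 < eps <= 8^-1 ->
  \forall n \near \oo%classic, [/\ 1 <= logn n,
    40 * logn n ^+ 2 <= expR (eps * logn n) & (0 < n)%N].
Proof.
move=> /andP[e0 _]; have := near_sqr_logn_le 40 e0.
have := near_and (near_logn_ge (1 : R)) (nbhs_infty_ge 1).
by apply: filterS2 => n [l1 n1] lW.
Qed.

Definition lower_target (gamma : nat -> R) eps n : R :=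
  (eta_exp gamma n.+1 - eps) * query_rate gamma n.+1.

Lemma lower_target_lt gamma eps n (r : nat) :
  (Num.truncn (lower_target gamma eps n) < r)%N -> lower_target gamma eps n <= r%:R.
Proof.
set X := lower_target _ _ _ => Xr; have [X0|X0] := leP 0 X; last first.
  by rewrite (le_trans (ltW X0)).
have /andP[_ /ltW/le_trans] := truncn_itv X0; apply.
by rewrite ler_nat.
Qed.

Lemma SQC_lower_aas (eps : R) : 0 < eps <= 8^-1 ->
  aas q (fun n A => forall r, SQC A = Some r -> lower_target gs eps n <= r%:R).
Proof.
move=> he; apply: (aas_intro hq) => d d0.
have := near_expR_logn_le (@ltr01 R) d0; have := near_lower_bound he.
apply: filterS2 => n [l1 lW n0] ld.
have [hg _ _] := gamma_sqc_bounds n.+1.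
have he1 : 0 < eps <= 1 by case/andP: he => *; apply/andP; split; lra.
have [_ est] := lower_bound_estimate hg he1 l1 lW.
set r0 := Num.truncn _ in est.
have r0E : r0 = Num.truncn (lower_target gs eps n) by [].
clearbody r0.
apply: le_trans ld; rewrite mul1r; apply: le_trans est.
rewrite [leRHS]mulrC.
pose bad S (A : 'M[bool]_n.+1) := (#|constant_cols (majority n.+1) S A| <= 1)%N : Prop.
apply: (@le_trans _ _ (random_matrix_prob (q n.+1)
    (fun A => exists2 S : {set 'I_n.+1}, (#|S| <= r0)%N & bad S A))).
  apply: (prob_mono (hq n.+1)) => A nA; apply: contrapT => nbad; apply: nA => r rA.
  apply: lower_target_lt; rewrite -r0E; apply: (@SQC_lower _ _ (majority n.+1) _ _ _ rA) => S Sr.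
  by rewrite ltnNge; apply/negP => badS; apply: nbad; exists S.
apply: (prob_small_sets (hq n.+1)) => [|S Sr].
  by rewrite !mulr_ge0 ?expR_ge0.
apply: (le_trans (few_majority_cols_prob n0 Sr)).
have [/andP[g2 _] _ _] := gamma_sqc_bounds n.+1.
have x0 : 0 <= n.+1%:R * gs n.+1 ^+ r0 by rewrite mulr_ge0 ?exprn_ge0 //; lra.
(* Weakened to the shape of the birthday bound, so that one estimate serves SQC and QC. *)
apply: (@le_trans _ _ (1 * n.+1%:R * expR (- (n.+1%:R * gs n.+1 ^+ r0 / 8)))).
  by rewrite mul1r ler_wpM2l // ler_expR lerN2; lra.
have e1 : 1 <= expR 1 :> R by have := expR_ge1Dx (1 : R); lra.
by rewrite ler_wpM2r ?expR_ge0 // ler_wpM2r.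
Qed.

Lemma QC_lower_aas (eps : R) : 0 < eps <= 8^-1 ->
  aas q (fun n A => forall r, QC A = Some r -> lower_target gq eps n <= r%:R).
Proof.
move=> he; apply: (aas_intro hq) => d d0.
have := near_expR_logn_le (@ltr01 R) d0; have := near_lower_bound he.
apply: filterS2 => n [l1 lW n0] ld.
have [hg _] := gamma_qc_bounds n.+1.
have he1 : 0 < eps <= 1 by case/andP: he => *; apply/andP; split; lra.
have [m1 est] := lower_bound_estimate hg he1 l1 lW.
set r0 := Num.truncn _ in m1 est.
have r0E : r0 = Num.truncn (lower_target gq eps n) by [].
clearbody r0.
apply: le_trans ld; rewrite mul1r; apply: le_trans est.
rewrite [leRHS]mulrC.
pose bad S (A : 'M[bool]_n.+1) := injective (restr_col A S).
apply: (@le_trans _ _ (random_matrix_prob (q n.+1)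
    (fun A => exists2 S : {set 'I_n.+1}, (#|S| <= r0)%N & bad S A))).
  apply: (prob_mono (hq n.+1)) => A nA; apply: contrapT => nbad; apply: nA => r rA.
  apply: lower_target_lt; rewrite -r0E; apply: (QC_lower _ rA) => S Sr injS.
  by apply: nbad; exists S.
apply: (prob_small_sets (hq n.+1)) => [|S Sr].
  by rewrite !mulr_ge0 ?expR_ge0.
apply: (le_trans (distinct_cols_prob_le (hq n.+1) S)).
case/andP: hg => g2 g1; pose m := n.+1%:R * gq n.+1 ^+ #|S|.
have mle : n.+1%:R * gq n.+1 ^+ r0 <= m.
  by rewrite ler_wpM2l // ler_wiXn2l // ?(ltW g1) // (le_trans _ g2) // invr_ge0.
apply: (le_trans (birthday (restrict_law_ge0 (hq n.+1) S) _ (sum_restrict_law _ _)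
  (le_trans m1 mle) _)) => //.
  by rewrite sum_restrict_law2 -gamma_qc_sqr exprMn -!exprM mulnC.
by rewrite ler_wpM2l ?mulr_ge0 ?expR_ge0 // ler_expR lerN2 ler_pM2r.
Qed.

Lemma distinct_cols_aas : much_less (@logN_over_N R) (fun N => 1 - gs N) ->
  aas q (fun n A => injective (restr_col A [set: 'I_n.+1]%SET)).
Proof.
move=> hs; apply: (aas_intro hq) => d d0.
have p0 N : 0 < 1 - gs N by have [/andP[_ ?] _ _] := gamma_sqc_bounds N; lra.
(* The constant 3 leaves N^2 e^(-3 ln N) = 1 / N for the collision probability. *)
have := near_expR_logn_le (@ltr01 R) d0; have := near_ge_logN p0 (ltr0n R 3) hs.
apply: filterS2 => n np ld.
apply: le_trans ld; rewrite mul1r.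
apply: (le_trans (col_collision_prob (hq n.+1) _)).
rewrite cardsT card_ord.
have [/andP[_ g1] pq p1q] := gamma_sqc_bounds n.+1.
have /andP[q0 q1] := hq n.+1.
set x := 1 - (q n.+1 ^+ 2 + (1 - q n.+1) ^+ 2).
have px : 1 - gs n.+1 <= x.
  have [h|h] := leP (q n.+1) 2^-1.
    apply: (le_trans pq); rewrite /x !expr2.
    by have := ler_wpM2l (ltW q0) (_ : 2^-1 <= 1 - q n.+1); lra.
  apply: (le_trans p1q); rewrite /x !expr2.
  by have := ler_wpM2r (_ : 0 <= 1 - q n.+1) (ltW h); lra.
have x1 : 0 <= x <= 1.
  apply/andP; split; first by have := p0 n.+1; lra.
  by have := sqr_ge0 (q n.+1); have := sqr_ge0 (1 - q n.+1); rewrite /x; lra.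
have -> : q n.+1 ^+ 2 + (1 - q n.+1) ^+ 2 = 1 - x by rewrite /x; ring.
apply: (@le_trans _ _ (n.+1%:R ^+ 2 * expR (- (n.+1%:R * x)))).
  by rewrite ler_wpM2l ?exprn_ge0 // one_minus_exp_le.
rewrite -{1}(expR_logn R n) -expRM_natl -expRD ler_expR.
have := ler_wpM2l (ler0n R n.+1) px; lra.
Qed.

(** A single T fails with probability at most N^(-2 |T|); summed over the nonempty T this is (1 +
    N^-2)^N - 1, at most 2 / N. *)
Lemma balanced_aas (eps : R) : 0 < eps <= 8^-1 ->
  much_less (@logN_over_N R) (fun N => 1 - gs N) ->
  aas q (fun n A => forall T : {set 'I_n.+1},
    eps * logn n / (1 - gs n.+1) <= #|T|%:R ->
    exists i, forall b,
      (1 - eps) * (1 - gs n.+1) * #|T|%:R <= (row_count A T b i)%:R).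
Proof.
move=> /andP[e0 e8] hs; apply: (aas_intro hq) => d d0.
have p0 N : 0 < 1 - gs N by have [/andP[_ ?] _ _] := gamma_sqc_bounds N; lra.
(* Chosen so that eps^2 / 8 times p N is at least 2 ln N. *)
have c0 : 0 < 16 / eps ^+ 2 by rewrite divr_gt0 ?exprn_gt0.
have d2 : 0 < d / 2 by lra.
(* Then eps^2 / 8 times p |T| is at least 1, so half of the Chernoff exponent absorbs the factor
   2. *)
have l_large := near_logn_ge (8 / eps ^+ 3).
have l_one := near_logn_ge (1 : R).
have := near_and (near_expR_logn_le (@ltr01 R) d2) (near_and l_one l_large).
have := near_ge_logN p0 c0 hs.
apply: filterS2 => n np [ld [l1 l8]].
have [/andP[_ g1] pq p1q] := gamma_sqc_bounds n.+1.
move: (p0 n.+1) np pq p1q; set p := 1 - gs n.+1 => {}p0 np pq p1q.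
set K := eps * logn n / p.
pose bad (T : {set 'I_n.+1}) (A : 'M[bool]_n.+1) := forall i, exists b,
  (row_count A T b i)%:R < (1 - eps) * p * #|T|%:R.
apply: (@le_trans _ _ (random_matrix_prob (q n.+1)
    (fun A => exists2 T : {set 'I_n.+1}, K <= #|T|%:R & bad T A))).
  apply: (prob_mono (hq n.+1)) => A nA; apply: contrapT => nbad; apply: nA => T KT.
  apply: contrapT => nex; apply: nbad; exists T => // i.
  apply: contrapT => nb; apply: nex; exists i => b; rewrite leNgt; apply/negP => lt_b.
  by apply: nb; exists b.
apply: (le_trans (prob_exists (hq n.+1) _ _)).
pose x : R := expR (- (2 * logn n)).
have K0 : 0 < K by rewrite divr_gt0 // mulr_gt0 //; lra.
have bad_le (T : {set 'I_n.+1}) : K <= #|T|%:R ->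
    random_matrix_prob (q n.+1) (bad T) <= x ^+ #|T|.
  move=> KT; have e01 : 0 < eps <= 1 by apply/andP; split; lra.
  apply: (le_trans (unbalanced_rows_prob (hq n.+1) T e01 (ltW p0) pq p1q)).
  set t : R := #|T|%:R in KT *.
  have pt : eps * logn n <= p * t by move: KT; rewrite /K ler_pdivrMr // [t * p]mulrC.
  have e1 : 1 <= eps ^+ 2 / 8 * (p * t).
    apply: (@le_trans _ _ (eps ^+ 2 / 8 * (eps * logn n))).
      move: l8; rewrite ler_pdivrMr ?exprn_gt0 // => l8.
      have -> : eps ^+ 2 / 8 * (eps * logn n) = (logn n * eps ^+ 3) / 8 by ring.
      by rewrite ler_pdivlMr // mul1r.
    by rewrite ler_wpM2l // divr_ge0 // sqr_ge0.
  have two : 2 <= expR (eps ^+ 2 / 8 * (p * t)).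
    apply: (@le_trans _ _ (expR 1)); last by rewrite ler_expR.
    by have := expR_ge1Dx (1 : R); lra.
  apply: (@le_trans _ _ (expR (- (eps ^+ 2 / 8 * (p * t))) ^+ n.+1)).
    apply: lerXn2r; rewrite ?nnegrE ?mulr_ge0 ?expR_ge0 //.
    have -> : - (eps ^+ 2 / 8 * (p * t))
      = eps ^+ 2 / 8 * (p * t) + - (eps ^+ 2 / 4 * p * t) by field.
    by rewrite expRD ler_wpM2r ?expR_ge0.
  rewrite /x -expRM_natl -[leRHS]expRM_natl ler_expR -/t !mulrN lerN2.
  have -> : n.+1%:R * (eps ^+ 2 / 8 * (p * t)) = t * (eps ^+ 2 / 8 * (p * n.+1%:R)) by ring.
  rewrite ler_wpM2l ?ler0n //.
  have h : 0 <= eps ^+ 2 / 8 by rewrite divr_ge0 // sqr_ge0.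
  have := ler_wpM2l h np.
  have -> : eps ^+ 2 / 8 * (16 / eps ^+ 2 * logn n) = 2 * logn n.
    by field; rewrite lt0r_neq0.
  by [].
apply: (@le_trans _ _ ((1 + x) ^+ n.+1 - 1)).
  rewrite -[X in _ ^+ X]card_ord -sum_exp_card.
  rewrite [X in _ <= X - _](bigD1 (finset.set0 : {set 'I_n.+1})) //=.
  rewrite cards0 expr0 addrC addrK big_mkcond [leRHS]big_mkcond /=.
  apply: ler_sum => T _; have xT : 0 <= x ^+ #|T| by rewrite exprn_ge0 // expR_ge0.
  case: ifP => KT; last by case: ifP.
  rewrite ifT ?bad_le //; apply/eqP => T0; move: KT; rewrite T0 cards0; lra.
have Nx : n.+1%:R * x = expR (- logn n).
  by rewrite -{1}(expR_logn R n) -expRD; congr expR; lra.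
have half : expR (- logn n) <= 2^-1.
  rewrite expRN expR_logn lef_pV2 ?posrE // ler_nat ltnS lt0n.
  by apply: contraTneq l1 => ->; rewrite ln1 -ltNge.
have x0 : 0 < x by exact: expR_gt0.
have : (1 + x) ^+ n.+1 <= expR (n.+1%:R * x).
  by rewrite expRM_natl; apply: lerXn2r; rewrite ?nnegrE ?expR_ge0 ?expR_ge1Dx //; lra.
rewrite Nx; move: ld half; rewrite mul1r; set y := expR (- logn n) => ld half hx.
have : expR y <= 1 + 2 * y.
  have y0 : 0 < y by exact: expR_gt0.
  have : 1 - y <= expR (- y) by exact: expR_ge1Dx.
  rewrite expRN -[leLHS]invrK lef_pV2 ?posrE ?expR_gt0 ?invr_gt0; last by lra.
  move=> /le_trans; apply; rewrite -div1r ler_pdivrMr; last by lra.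
  have : 0 <= y * (1 - 2 * y) by rewrite mulr_ge0; lra.
  lra.
lra.
lra.
Qed.

Lemma SQC_by_greedy_aas (eps : R) : 0 < eps <= 8^-1 ->
  much_less (@logN_over_N R) (fun N => 1 - gs N) ->
  aas q (fun n A => exists2 r : nat, SQC_by greedy A = Some r &
    r%:R <= (1 + eps) * query_rate gs n.+1).
Proof.
(* [greedy_steps] loses a factor 1 + 7 [de], which stays below 1 + eps. *)
move=> /andP[e0 e8] hs; pose de := eps / 8.
have he : 0 < de <= 8^-1 by apply/andP; rewrite /de; split; lra.
apply: (aas_mono hq) (aas_and hq (balanced_aas he hs) (distinct_cols_aas hs)).
have := near_logn_ge de^-1; have := near_logn_ge (1 : R).
apply: filterS2 => n l1 le A [bal injA].
have [hg pq p1q] := gamma_sqc_bounds n.+1.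
have del : 1 <= de * logn n.
  by rewrite mulrC -ler_pdivrMr; [rewrite div1r|case/andP: he].
have [J [M [NJ KM JM]]] := greedy_steps hg he del.
have idr : identifies greedy A (J + M).
  apply: (greedy_identifies injA _ _ NJ KM).
    case/andP: hg he => g2 g1 /andP[d0 d8].
    have : 0 <= de * (1 - gs n.+1) by rewrite mulr_ge0; lra.
    have : 0 <= (1 - de) * (1 - gs n.+1) by rewrite mulr_ge0; lra.
    by move=> h1 h2; apply/andP; split; lra.
  move=> T /bal[i hi]; exists i => b.
  by rewrite subKr.
have [r rA [rJM _]] := minimum_le idr; exists r => //.
apply: (@le_trans _ _ (J + M)%:R); first by rewrite ler_nat.
apply: (le_trans JM); rewrite ler_wpM2r //; last by rewrite /de; lra.
have [L0 _ _ _ _] := ln_inv_bounds hg.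
by rewrite divr_ge0 ?ltW //; lra.
Qed.

(** The bound gives N ln (1 / gamma) <= (ln N) / 2, so N gamma^N >= N^(1/2) and constant columns
    abound. The explicit constant 1/4 lets case (ii) of both SQC and QC use it. *)
Lemma equal_cols_aas :
  (\forall n \near \oo%classic, (1 - gs n.+1) * n.+1%:R <= 4^-1 * logn n) ->
  aas q (fun n A =>
    (1 < #|constant_cols (majority n.+1) [set: 'I_n.+1]%SET A|)%N).
Proof.
move=> hs; apply: (aas_intro hq) => d d0.
have half : 0 < 2^-1 :> R by lra.
have := near_and (near_expR_logn_le (@ltr01 R) d0) (near_sqr_logn_le 4 half).
have := near_and hs (near_and (near_logn_ge (1 : R)) (nbhs_infty_ge 1)).
apply: filterS2 => n [np [l1 n1]] [ld lW].
apply: le_trans ld; rewrite mul1r.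
apply: (@le_trans _ _ (random_matrix_prob (q n.+1)
    (fun A => (#|constant_cols (majority n.+1) [set: 'I_n.+1]%SET A| <= 1)%N))).
  by apply: (prob_mono (hq n.+1)) => A /negP; rewrite -leqNgt.
have cT : (#|[set: 'I_n.+1]%SET| <= n.+1)%N by rewrite cardsT card_ord.
apply: (le_trans (few_majority_cols_prob n1 cT)).
have [hg _ _] := gamma_sqc_bounds n.+1; have [L0 L1 _ Lp gL] := ln_inv_bounds hg.
rewrite -{1}gL -expRM_natr.
rewrite -{1 2}(expR_logn R n) -expRD -expRD ler_expR.
set L := ln _ in Lp *.
have LN : L * n.+1%:R <= 2^-1 * logn n.
  by have := ler_wpM2r (ler0n R n.+1) Lp; lra.
have : expR (2^-1 * logn n) <= expR (logn n + - L * n.+1%:R).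
  by rewrite ler_expR; lra.
have ll : logn n <= logn n ^+ 2 by rewrite expr2 ler_peMr; lra.
lra.
Qed.

Lemma QC_upper_aas (eps : R) : 0 < eps <= 8^-1 ->
  much_less (@logN_over_N R) (fun N => 1 - gq N) ->
  aas q (fun n A => exists2 r : nat, QC A = Some r &
    r%:R <= (1 + eps) * query_rate gq n.+1).
Proof.
move=> /andP[e0 e8] hs; apply: (aas_intro hq) => d d0.
have p0 N : 0 < 1 - gq N by have [/andP[_ ?] _] := gamma_qc_bounds N; lra.
have := near_and (near_expR_logn_le e0 d0) (near_logn_ge (2 / eps)).
(* The constant 4 bounds the rate by N / 4, so that the first r rows exist. *)
have := near_ge_logN p0 (ltr0n R 4) hs.
apply: filterS2 => n np [ld l1].
apply: le_trans ld.
have [hg _] := gamma_qc_bounds n.+1; have [L0 L1 pL _ gL] := ln_inv_bounds hg.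
set L := ln _ in L0 L1 pL gL.
have l2 : 2 <= eps * logn n by move: l1; rewrite ler_pdivrMr // mulrC.
have lg : 0 < logn n by rewrite -(pmulr_rgt0 _ e0); lra.
pose Y := (1 + eps / 2) * (logn n / L).
have lL : 0 < logn n / L by rewrite divr_gt0.
have Y0 : 0 <= Y by rewrite mulr_ge0; lra.
have [r /andP[Yr rY]] := next_nat Y0.
have r_le : r%:R <= (1 + eps) * (logn n / L).
  have : 1 <= eps / 2 * (logn n / L).
    by rewrite mulrA ler_pdivlMr //; lra.
  by rewrite /Y in rY *; lra.
have rN : (r <= n.+1)%N.
  rewrite -(ler_nat R); apply: (le_trans r_le).
  have : logn n / L <= n.+1%:R / 4.
    rewrite ler_pdivrMr // mulrAC ler_pdivlMr //.
    by have := ler_wpM2r (ler0n R n.+1) pL; lra.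
  by have : 0 <= eps * (8^-1 - eps); [rewrite mulr_ge0; lra|nra].
pose S := [set i : 'I_n.+1 | (i < r)%N]%SET.
have cS : #|S| = r.
  rewrite -sum1_card (eq_bigl (fun i : 'I_n.+1 => (i < r)%N)); last by move=> i; rewrite inE.
  by rewrite (big_ord_narrow rN) sum1_card card_ord.
apply: (@le_trans _ _ (random_matrix_prob (q n.+1)
    (fun A => ~ injective (restr_col A S)))).
  apply: (prob_mono (hq n.+1)) => A nA injS; apply: nA.
  have [|r' QCr [r'r _]] := @minimum_le (fun r => exists R : {set 'I_n.+1},
    #|R| = r /\ injective (restr_col A R)) r; first by exists S.
  exists r' => //; apply: le_trans r_le; by rewrite ler_nat.
apply: (le_trans (col_collision_prob (hq n.+1) _)).
rewrite -gamma_qc_sqr cS -{1}(expR_logn R n) -!expRM_natl -gL -expRM_natl -expRM_natr.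
rewrite -expRD ler_expR.
have : (1 + eps / 2) * logn n <= L * r%:R.
  move: (ltW Yr); rewrite /Y mulrA ler_pdivrMr // => h.
  by rewrite [L * _]mulrC.
lra.
Qed.

End Main.

Theorem theorem3 (R : realType) (q : nat -> R) (hq : forall N, 0 < q N < 1) :
  let gs := gamma_sqc q in
  let gq := gamma_qc q in
  [/\ (* (i) *)
      (forall N, 1 - gs N <= 1) ->
      much_less (@logN_over_N R) (fun N => 1 - gs N) ->
      [/\ exists e : nat -> R, little_o1 e /\
            aas q (fun n A => exists2 r : nat, SQC A = Some r &
              (eta_exp gs n.+1 - e n.+1) * query_rate gs n.+1 <= r%:R),
          exists e : nat -> R, little_o1 e /\
            aas q (fun n A => exists2 r : nat, SQCP A = Some r &
              r%:R <= (1 + e n.+1) * query_rate gs n.+1)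
        & exists g : strategy, polynomial_time g /\
            exists e : nat -> R, little_o1 e /\
            aas q (fun n A => exists2 r : nat, SQC_by g A = Some r &
              r%:R <= (1 + e n.+1) * query_rate gs n.+1)],
      (* (ii) *)
      much_less (fun N => 1 - gs N) (@logN_over_N R) ->
      aas q (fun n A => SQC A = None),
      (* (i) for QC *)
      much_less (@logN_over_N R) (fun N => 1 - gq N) ->
      exists e1 e2 : nat -> R, [/\ little_o1 e1, little_o1 e2 &
        aas q (fun n A => exists2 r : nat, QC A = Some r &
          (eta_exp gq n.+1 - e1 n.+1) * query_rate gq n.+1 <= r%:R
            <= (1 + e2 n.+1) * query_rate gq n.+1)]
    & (* (ii) for QC *)
      much_less (fun N => 1 - gq N) (@logN_over_N R) ->
      aas q (fun n A => QC A = None)].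
Proof.
move=> gs gq; split.
- move=> _ hs.
  have up eps : 0 < eps <= 8^-1 -> aas q (fun n A =>
      exists2 r : nat, SQC_by greedy A = Some r & r%:R <= (1 + eps) * query_rate gs n.+1).
    by move=> he; exact: SQC_by_greedy_aas.
  split.
  + apply: (aas_diagonal hq (E := fun eps n A => exists2 r : nat, SQC A = Some r &
      (eta_exp gs n.+1 - eps) * query_rate gs n.+1 <= r%:R)) => eps he.
    (* The lower bound speaks only of defined values; that SQC is defined comes from the success of
       the greedy strategy. *)
    apply: (aas_mono hq) (aas_and hq (SQC_lower_aas hq he) (up _ he)).
    apply: nearW => n A [lowA [r /minimum_Some idr _]].
    have [|r' SQCr _] := @minimum_le (fun r => exists g : strategy, identifies g A r) r.
      by exists greedy.
    by exists r' => //; exact: lowA.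
  + apply: (aas_diagonal hq (E := fun eps n A => exists2 r : nat, SQCP A = Some r &
      r%:R <= (1 + eps) * query_rate gs n.+1)) => eps he.
    apply: (aas_mono hq) (up _ he).
    apply: nearW => n A [r /minimum_Some idr r_le].
    have [|r' SQCPr [r'r _]] := @minimum_le (fun r => exists g : strategy,
        polynomial_time g /\ identifies g A r) r.
      by exists greedy; split=> //; exact: greedy_polynomial_time.
    by exists r' => //; apply: le_trans r_le; rewrite ler_nat.
  + exists greedy; split; first exact: greedy_polynomial_time.
    exact: (aas_diagonal hq (E := fun eps n A => exists2 r : nat,
      SQC_by greedy A = Some r & r%:R <= (1 + eps) * query_rate gs n.+1)).
- move=> hs; apply: (aas_mono hq) (equal_cols_aas hq _).
    by apply: nearW => n A; exact: SQC_None.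
  by apply: (near_le_logN _ hs); rewrite invr_gt0.
- move=> hs.
  have [e1 [e10 low]] := aas_diagonal hq (E := fun eps n A => forall r, QC A = Some r ->
    lower_target gq eps n <= r%:R) (fun eps he => QC_lower_aas hq he).
  have [e2 [e20 up]] := aas_diagonal hq (E := fun eps n A => exists2 r : nat,
    QC A = Some r & r%:R <= (1 + eps) * query_rate gq n.+1)
    (fun eps he => QC_upper_aas hq he hs).
  exists e1, e2; split=> //; apply: (aas_mono hq) (aas_and hq low up).
  apply: nearW => n A [lowA [r QCr r_le]]; exists r => //.
  by apply/andP; split=> //; exact: lowA.
- move=> hs; apply: (aas_mono hq) (equal_cols_aas hq _).
    by apply: nearW => n A; exact: QC_None.
  (* Passing from gamma_qc to gamma_sqc costs a factor 2, turning 1/8 into the required 1/4. *)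
  have c0 : 0 < 8^-1 :> R by rewrite invr_gt0.
  have := near_le_logN c0 hs; apply: filterS => n h.
  have [_ p2] := gamma_qc_bounds hq n.+1.
  have := ler_wpM2r (ler0n R n.+1) p2; rewrite -/gq.
  by move: h; rewrite -/gq; lra.
Qed.
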